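(* Let $p$ be a prime and $d$ an integer with $1<d<p$ and $\phi(d)\le 2$ ($\phi$ Euler's totient). Then \[ {}_2G\left(\tfrac1d, 1-\tfrac1d\right)_p \equiv {}_2F_1\left[\begin{matrix} \tfrac1d, & 1-\tfrac1d\\ & 1\end{matrix}\;\Big|\;1\right]_{p-1} \pmod{p^2}. \]
   Context: Truncated hypergeometric series: ${}_rF_s\left[\begin{matrix} a_1,\dots,a_r\\ b_1,\dots,b_s\end{matrix}\,\Big|\, z\right]_m := \sum_{n=0}^{m} \frac{(a_1)_n\cdots(a_r)_n}{(b_1)_n\cdots(b_s)_n}\frac{z^n}{n!}$ with $(a)_0=1$, $(a)_n=a(a+1)\cdots(a+n-1)$. Congruences are in $\mathbb{Z}_p$. The $p$-adic gamma function: for $n\in\mathbb{N}$, $\Gamma_p(n)=(-1)^n\prod_{j<n,\,p\nmid j} j$, extended continuously to $\mathbb{Z}_p$ by $\Gamma_p(x)=\lim_{n\to x}\Gamma_p(n)$, with $\Gamma_p(0)=1$. The Teichmüller character $\omega:\mathbb{F}_p\to\mathbb{Z}_p$ is the multiplicative character with $\omega(x)\equiv x \pmod p$ (and $\omega(0)=0$). For an odd prime $p$, positive integers $m_i,d_i$ ($1\le i\le n+1$) with $p\nmid d_i$ and $0<\frac{m_1}{d_1}\le\cdots\le\frac{m_{n+1}}{d_{n+1}}<1$, define \[ {}_{n+1}G\left(\tfrac{m_1}{d_1},\dots,\tfrac{m_{n+1}}{d_{n+1}}\right)_p := \frac{-1}{p-1}\sum_{k=0}^{n+1}(-p)^k\sum_{j=\lfloor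 m_kr_k\rfloor+1}^{\lfloor m_{k+1}r_{k+1}\rfloor}\omega^{j(n+1)}(-1)\,\Gamma_p\!\left(\tfrac{j}{p-1}\right)^{n+1}\prod_{i=k+1}^{n+1}\frac{\Gamma_p\!\left(\frac{m_i}{d_i}-\frac{j}{p-1}\right)}{\Gamma_p\!\left(\frac{m_i}{d_i}\right)}\prod_{i=1}^{k}\frac{\Gamma_p\!\left(\frac{d_i+m_i}{d_i}-\frac{j}{p-1}\right)}{\Gamma_p\!\left(\frac{m_i}{d_i}\right)}, \] where $r_i=\frac{p-1}{d_i}$, $m_0=-1$, $m_{n+2}=p-2$, $d_0=d_{n+2}=p-1$. The arguments of $G$ may be listed in any order; the meaning is that of the arguments sorted ascending. *)

(* Defs.v *)
From HB Require Import structures.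
From mathcomp Require Import all_boot all_order all_algebra.
From mathcomp Require Import boolp classical_sets.

Set Implicit Arguments.
Unset Strict Implicit.
Unset Printing Implicit Defensive.

Import Order.TTheory GRing.Theory Num.Theory.
Local Open Scope ring_scope.

(** * The ring of p-adic integers, as the inverse limit of the rings
    Z/p^(n+1) along the reduction maps.  The exponent starts at 1 because
    ['Z_1] denotes Z/2 in MathComp.  The proof of primality is a parameter of
    the type so that the ring structure can be found by inference. *)

Definition padic_coherent (p : nat) (x : forall n, 'Z_(p ^ n.+1)) : Prop :=
  forall n, (x n.+1 %% p ^ n.+1)%N = x n.

Record padic_int (p : nat) (p_pr : prime p) := PadicInt {
  padic_val :> forall n, 'Z_(p ^ n.+1);
  _ : `[< padic_coherent padic_val >] }.

HB.instance Definition _ p (p_pr : prime p) :=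
  [isSub for @padic_val p p_pr].
HB.instance Definition _ p (p_pr : prime p) :=
  [Equality of padic_int p_pr by <:].
HB.instance Definition _ p (p_pr : prime p) :=
  [Choice of padic_int p_pr by <:].

Section PadicRing.
Variables (p : nat) (p_pr : prime p).
Local Notation Zp := (padic_int p_pr).
Implicit Types x y z : Zp.

Lemma padicP x n : (x n.+1 %% p ^ n.+1)%N = x n.
Proof. by case: x => x hx /=; move/asboolP: hx; apply. Qed.

Lemma eq_padic x y : (forall n, x n = y n) -> x = y.
Proof. by move=> exy; apply/val_inj/functional_extensionality_dep. Qed.

Lemma padic_modulus_gt1 n : (1 < p ^ n.+1)%N.
Proof. by rewrite -(exp1n n.+1) ltn_exp2r // prime_gt1. Qed.

Let modK n : (Zp_trunc (p ^ n.+1)).+2 = (p ^ n.+1)%N.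
Proof. exact/Zp_cast/padic_modulus_gt1. Qed.

Let modS n m : (m %% p ^ n.+2 = m %[mod p ^ n.+1])%N.
Proof. by apply: modn_dvdm; apply: dvdn_exp2l. Qed.

Lemma padic_zero_subproof : `[< padic_coherent (fun n => 0 : 'Z_(p ^ n.+1)) >].
Proof. by apply/asboolP => n; rewrite mod0n. Qed.
Definition padic_zero : Zp := PadicInt p_pr padic_zero_subproof.

Lemma padic_one_subproof : `[< padic_coherent (fun n => 1 : 'Z_(p ^ n.+1)) >].
Proof. by apply/asboolP => n /=; rewrite modn_small // padic_modulus_gt1. Qed.
Definition padic_one : Zp := PadicInt p_pr padic_one_subproof.

Lemma padic_opp_subproof x : `[< padic_coherent (fun n => - x n) >].
Proof.
apply/asboolP => n /=; have := padicP x n; have := ltn_ord (x n.+1).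
move: (nat_of_ord (x n.+1)) (nat_of_ord (x n)) => a b.
rewrite !modK modS => lt_a <-.
have le_am : (a %% p ^ n.+1 <= p ^ n.+1)%N.
  by rewrite ltnW // ltn_pmod // expn_gt0 prime_gt0.
apply/eqP; rewrite -(eqn_modDr a) subnK 1?ltnW // -modnDmr subnK //.
by rewrite modnn; apply: dvdn_exp2l.
Qed.
Definition padic_opp x : Zp := PadicInt p_pr (padic_opp_subproof x).

Lemma padic_add_subproof x y : `[< padic_coherent (fun n => x n + y n) >].
Proof.
apply/asboolP => n /=; have := padicP x n; have := padicP y n.
move: (nat_of_ord (x n.+1)) (nat_of_ord (x n)) => a b.
move: (nat_of_ord (y n.+1)) (nat_of_ord (y n)) => c e.
by rewrite !modK modS => <- <-; rewrite modnDm.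
Qed.
Definition padic_add x y : Zp := PadicInt p_pr (padic_add_subproof x y).

Lemma padic_mul_subproof x y : `[< padic_coherent (fun n => x n * y n) >].
Proof.
apply/asboolP => n /=; have := padicP x n; have := padicP y n.
move: (nat_of_ord (x n.+1)) (nat_of_ord (x n)) => a b.
move: (nat_of_ord (y n.+1)) (nat_of_ord (y n)) => c e.
by rewrite !modK modS => <- <-; rewrite modnMm.
Qed.
Definition padic_mul x y : Zp := PadicInt p_pr (padic_mul_subproof x y).

Fact padic_addA : associative padic_add.
Proof. by move=> x y z; apply: eq_padic => n; apply: addrA. Qed.
Fact padic_addC : commutative padic_add.
Proof. by move=> x y; apply: eq_padic => n; apply: addrC. Qed.
Fact padic_add0 : left_id padic_zero padic_add.
Proof. by move=> x; apply: eq_padic => n; apply: add0r. Qed.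
Fact padic_addN : left_inverse padic_zero padic_opp padic_add.
Proof. by move=> x; apply: eq_padic => n; apply: addNr. Qed.

HB.instance Definition _ := GRing.isZmodule.Build (padic_int p_pr)
  padic_addA padic_addC padic_add0 padic_addN.

Fact padic_mulA : associative padic_mul.
Proof. by move=> x y z; apply: eq_padic => n; apply: mulrA. Qed.
Fact padic_mulC : commutative padic_mul.
Proof. by move=> x y; apply: eq_padic => n; apply: mulrC. Qed.
Fact padic_mul1 : left_id padic_one padic_mul.
Proof. by move=> x; apply: eq_padic => n; apply: mul1r. Qed.
Fact padic_mulD : left_distributive padic_mul +%R.
Proof. by move=> x y z; apply: eq_padic => n; apply: mulrDl. Qed.
Fact padic_one_neq0 : padic_one != 0.
Proof. by apply/eqP => /(congr1 (fun x : Zp => val (x 0%N))). Qed.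

HB.instance Definition _ := GRing.Zmodule_isComNzRing.Build (padic_int p_pr)
  padic_mulA padic_mulC padic_mul1 padic_mulD padic_one_neq0.

Definition padic_unit : {pred Zp} := fun x => `[< exists y, y * x = 1 >].
Definition padic_inv x : Zp := xget x [set y | y * x = 1].

Fact padic_mulV : {in padic_unit, left_inverse 1 padic_inv *%R}.
Proof.
move=> x /asboolP[y yx1]; rewrite /padic_inv.
by case: xgetP => [z _ //|] /(_ y).
Qed.
Fact padic_unitP x y : y * x = 1 -> padic_unit x.
Proof. by move=> yx1; apply/asboolP; exists y. Qed.
Fact padic_inv_out : {in [predC padic_unit], padic_inv =1 id}.
Proof.
move=> x /asboolPn nUx; rewrite /padic_inv.
by case: xgetP => // y _ yx1; case: nUx; exists y.
Qed.

HB.instance Definition _ := GRing.ComNzRing_hasMulInverse.Build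
  (padic_int p_pr) padic_mulV padic_unitP padic_inv_out.

End PadicRing.

Definition padic_eqmod (p : nat) (p_pr : prime p) (N : nat)
    (x y : padic_int p_pr) : Prop :=
  exists z : padic_int p_pr, x - y = p%:R ^+ N * z.

Section PadicFunctions.
Variables (p : nat) (p_pr : prime p).
Local Notation Zp := (padic_int p_pr).

(** f(n) tends to l as the natural number n tends p-adically to x. *)
Definition padic_lim_nat (f : nat -> Zp) (x l : Zp) : Prop :=
  forall N, exists M, forall n : nat,
    padic_eqmod M n%:R x -> padic_eqmod N (f n) l.

Definition padic_gamma_nat (n : nat) : Zp :=
  (-1) ^+ n * \prod_(0 <= j < n | ~~ (p %| j)%N) j%:R.

(** The limit exists and is unique for every x, so that the default value of
    [xget] plays no role. *)
Definition padic_gamma (x : Zp) : Zp :=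
  xget 0 [set l | padic_lim_nat padic_gamma_nat x l].

Definition is_teichmuller (w : {ffun 'F_p -> Zp}) : Prop :=
  [/\ w 0 = 0, w 1 = 1, {morph w : x y / x * y}
    & forall x : 'F_p, padic_eqmod 1 (w x) (nat_of_ord x)%:R].

(** Again, there is exactly one such w. *)
Definition teichmuller : {ffun 'F_p -> Zp} := xget [ffun=> 0] is_teichmuller.

(** The function G, with arguments the fractions m_i / d_i themselves: the
    defining formula depends on (m_i, d_i) only through this quotient, since
    m_i * r_i = (m_i / d_i) * (p - 1) and (d_i + m_i) / d_i = 1 + m_i / d_i.
    The arguments are meant to lie strictly between 0 and 1 and to have
    denominators prime to p, with p odd; [ratr] then maps every rational number
    occurring below to the corresponding element of Z_p. *)

(** [padicG_bound t k] is floor (m_k * r_k) + 1, for t the sorted list of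
    arguments, with the conventions m_0 / d_0 = -1 / (p - 1) and
    m_(n+2) / d_(n+2) = (p - 2) / (p - 1); it is nonnegative. *)
Definition padicG_bound (t : seq rat) (k : nat) : nat :=
  let q : rat := p%:R - 1 in
  let e : seq rat := (-1 / q) :: rcons t ((p%:R - 2) / q) in
  absz (Num.floor (e`_k * q) + 1).

(** Here t`_i stands for m_(i+1) / d_(i+1). *)
Definition padicG (s : seq rat) : Zp :=
  let t := sort <=%R s in
  let jq (j : nat) : rat := j%:R / (p%:R - 1) in
  (- 1 / (p%:R - 1)) *
  \sum_(0 <= k < (size t).+1) (- p%:R) ^+ k *
    \sum_(padicG_bound t k <= j < padicG_bound t k.+1)
      teichmuller (-1) ^+ (j * size t) *
      padic_gamma (ratr (jq j)) ^+ size t *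
      (\prod_(k <= i < size t)
         (padic_gamma (ratr (t`_i - jq j)) / padic_gamma (ratr t`_i))) *
      (\prod_(0 <= i < k)
         (padic_gamma (ratr (1 + t`_i - jq j)) / padic_gamma (ratr t`_i))).

End PadicFunctions.

Definition rising_factorial (F : fieldType) (a : F) (n : nat) : F :=
  \prod_(0 <= i < n) (a + i%:R).

Definition trunc_hypergeom (F : fieldType) (a b : seq F) (z : F) (m : nat) : F :=
  \sum_(0 <= n < m.+1)
    (\prod_(x <- a) rising_factorial x n) /
    (\prod_(x <- b) rising_factorial x n) * (z ^+ n / n`!%:R).

(* Main.v *)
(** Modulo p^2 the function Gamma_p factors through R = Z/p^2, where it is a
    function g with g (x + 1) = - x g x for x a unit and g (x + 1) = - g x
    otherwise.  Let w x be the product of the units among x, ..., x + p - 1.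
    Then g (x + p) = - w x g x, and w is p-periodic, so that g (x + p n) is
    (- w x)^n g x.

    Since p = 1 or - 1 modulo d, the numbers 1/d and 1 - 1/d are, in some order,
    - m + p/d and 1 + m - p/d, where m is the integral part of (p - 1)/d.  Put
    M = p - 1 - m and Q(x) = (x+1)...(x+m) (x+1)...(x+M), a monic polynomial of
    degree p - 1.  Replacing p/d by p in the gamma quotient
    g(-x)^2 g(1/d + x) g(1 - 1/d + x) turns it into Q(x) deprived of its nonunit
    factors, and costs only a p-periodic factor congruent to 1 modulo p.  As
    j/(p-1) = - (j + p j) in R, for j <= m the j-th terms of G and of the
    hypergeometric sum thus differ by p j Q'(j), up to a unit independent of j.
    The ranges m < j <= M and M < j < p are controlled by the simple and double
    zeros of Q modulo p there, and altogether the two sides differ by p times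
    the sum over 0 <= j < p of (x Q)'(j).  This vanishes: the leading
    coefficient of (x Q)' is p, and the sum of j^k over 0 <= j < p is divisible
    by p for k < p - 1. *)

Require Import Defs.
From HB Require Import structures.
From mathcomp Require Import all_boot all_order all_algebra.
From mathcomp Require Import boolp classical_sets ring lra zify.
Import Order.TTheory GRing.Theory Num.Theory.
Set Implicit Arguments.
Unset Strict Implicit.
Unset Printing Implicit Defensive.
Local Open Scope ring_scope.

(** * Power sums *)

(** Expanding (j+1)^(k+1) - j^(k+1) and telescoping over j < p writes p^(k+1) as a combination of
    the power sums of exponents at most k. By induction all but the last are divisible by p, and the
    last has coefficient k + 1 < p. *)
Lemma prime_dvd_power_sum p k :
  prime p -> (k < p.-1)%N -> (p %| \sum_(0 <= j < p) j ^ k)%N.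
Proof.
move=> p_pr; elim/ltn_ind: k => k IHk ltkp.
have tele : (\sum_(0 <= j < p) \sum_(i < k.+1) 'C(k.+1, i) * j ^ i
    = p ^ k.+1)%N.
  have H n : (\sum_(0 <= j < n) \sum_(i < k.+1) 'C(k.+1, i) * j ^ i
    = n ^ k.+1)%N.
    elim: n => [|n IHn]; first by rewrite big_nil exp0n.
    rewrite big_nat_recr //= IHn -[n.+1]add1n expnDn [RHS]big_ord_recr /= binn.
    rewrite mul1n subnn expn0 mul1n addnC; congr (_ + _)%N.
    by apply: eq_bigr => i _; rewrite exp1n mul1n.
  exact: H.
move: tele; rewrite exchange_big /= big_ord_recr /= => tele.
have: (p %| p ^ k.+1)%N by rewrite dvdn_exp.
rewrite -tele dvdn_addr; last first.
  elim/big_rec: _ => [|i x _ dvx]; first exact: dvdn0.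
  rewrite dvdn_addr // -big_distrr /= dvdn_mull // IHk //.
  exact: ltn_trans ltkp.
rewrite -big_distrr /= Euclid_dvdM // binSn => /orP[/dvdn_leq|//].
move: ltkp; lia.
Qed.

(** * Local rings in which p^2 = 0 *)

Section LocalSquareZero.
Variables (R : comUnitRingType) (p : nat).
Hypothesis p_pr : prime p.
Hypothesis p_odd : odd p.
Hypothesis p_sq0 : p%:R * p%:R = 0 :> R.
Hypothesis unit_natr : forall n, (n%:R \is a @GRing.unit R) = ~~ (p %| n)%N.
Hypothesis natr_surj : forall x : R, exists n, x = n%:R.

Local Notation P := (p%:R : R).

Lemma unitrDp (x y : R) : (x + P * y \is a GRing.unit) = (x \is a GRing.unit).
Proof.
have [n ->] := natr_surj x; have [k ->] := natr_surj y.
by rewrite -natrM -natrD !unit_natr dvdn_addl // dvdn_mulr.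
Qed.

Lemma mulp_Dp (x y : R) : P * (x + P * y) = P * x.
Proof. by rewrite mulrDr mulrA p_sq0 mul0r addr0. Qed.

(** The factor, up to sign, in the functional equation of Gamma_p, which skips the multiples of
    p. *)
Definition unit_or_1 (x : R) : R := if x \is a GRing.unit then x else 1.
Local Notation u := unit_or_1.

Lemma unit_or_1_unit x : u x \is a GRing.unit.
Proof. by rewrite /u; case: ifP => // _; apply: unitr1. Qed.

Lemma unit_or_1_id x : x \is a GRing.unit -> u x = x.
Proof. by rewrite /u => ->. Qed.

Lemma unit_or_1_sqrN x : u (- x) ^+ 2 = u x ^+ 2.
Proof. by rewrite /u unitrN; case: ifP => //; rewrite sqrrN. Qed.

Lemma mulp_unit_or_1Dp x y : P * u (x + P * y) = P * u x.
Proof. by rewrite /u unitrDp; case: ifP => //; rewrite mulp_Dp. Qed.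

Definition uprod (n : nat) (x : R) : R := \prod_(i < n) u (x + i%:R).
Local Notation w := (uprod p).

Lemma uprod_unit n x : uprod n x \is a GRing.unit.
Proof. by apply: rpred_prod => i _; apply: unit_or_1_unit. Qed.

Lemma uprodS x : w (x + 1) * u x = u (x + P) * w x.
Proof.
rewrite /uprod; case: p (prime_gt0 p_pr) => // n _.
rewrite big_ord_recr /= [in RHS]big_ord_recl /= addr0 -!addrA nat1r.
under eq_bigr => i _ do rewrite -addrA nat1r.
by rewrite [in LHS]mulrAC [RHS]mulrC [u x * _]mulrC.
Qed.

Lemma mulrI_unit (x y z : R) : z \is a GRing.unit -> z * x = z * y -> x = y.
Proof. by move=> Uz /(mulrI Uz). Qed.

(* The ratio w (x + p) / w x does not depend on x; its p-th power is 1 by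
   p^2 = 0, and its fourth power is 1 by the symmetry x -> - x. *)
Lemma uprod_per x : w (x + P) = w x.
Proof.
pose r x := w (x + P) / w x.
have wr y : w (y + P) = r y * w y by rewrite divrK ?uprod_unit.
have rS y : r (y + 1) = r y.
  have e1 := uprodS y; have e2 := uprodS (y + P).
  (* The square of y + P and the product of y and y + 2P differ by P^2 = 0. *)
  have eu : u (y + P + P) * u y = u (y + P) ^+ 2.
    have -> : y + P + P = y + P * 2%:R by ring.
    have -> : y + P = y + P * 1 by ring.
    rewrite /u !unitrDp; case: ifP => _; last by rewrite expr1n mulr1.
    transitivity ((y + P * 1) ^+ 2 - P * P); first by ring.
    by rewrite p_sq0 subr0.
  apply: (@mulrI_unit _ _ (w (y + 1) * u y * u (y + P))).
    by rewrite !unitrM uprod_unit !unit_or_1_unit.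
  rewrite {2}e1.
  have -> : w (y + 1) * u y * u (y + P) * r (y + 1)
     = (r (y + 1) * w (y + 1)) * u (y + P) * u y by ring.
  rewrite -wr addrAC e2 wr.
  transitivity (u (y + P + P) * u y * r y * w y); first by ring.
  by rewrite eu; ring.
have rc y : r y = r 0.
  have [n ->] := natr_surj y; elim: n => // n IHn.
  by rewrite -IHn -natr1 rS.
have wrc y : w (y + P) = r 0 * w y by rewrite wr rc.
have rp : r 0 ^+ p = 1.
  have H k : w (P * k%:R) = r 0 ^+ k * w 0.
    elim: k => [|k IHk]; first by rewrite mulr0 mul1r.
    by rewrite -natr1 mulrDr mulr1 wrc IHk exprS mulrA.
  have := H p; rewrite p_sq0 -{1}[w 0]mul1r => /esym.
  exact: (mulIr (uprod_unit _ _)).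
(* Negation reverses the window of p factors; the squares absorb the signs. *)
have wN y : w (- y) ^+ 2 = w (y + 1 - P) ^+ 2.
  rewrite /uprod -!prodrXl (reindex_inj rev_ord_inj) /=.
  apply: eq_bigr => i _; rewrite -unit_or_1_sqrN; congr (u _ ^+ 2).
  by rewrite natrB // -natr1; ring.
have r4 : r 0 ^+ 4 = 1.
  have e1 : w 0 = r 0 * w (- P) by rewrite -wrc addNr.
  have e2 : w 1 = r 0 * w (1 - P) by rewrite -wrc addrNK.
  have e3 : w 0 ^+ 2 = w (1 - P) ^+ 2 by have := wN 0; rewrite oppr0 add0r.
  have e4 : w (- P) ^+ 2 = w 1 ^+ 2 by rewrite wN addrAC subrr add0r.
  apply: (@mulrI_unit _ _ (w (1 - P) ^+ 2)).
    by rewrite unitrX ?uprod_unit.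
  have -> : w (1 - P) ^+ 2 * r 0 ^+ 4 = r 0 ^+ 2 * (r 0 * w (1 - P)) ^+ 2 by ring.
  by rewrite mulr1 -[RHS]e3 e1 -e2 -e4; ring.
suff r1 : r 0 = 1 by rewrite wrc r1 mul1r.
(* As p is odd, p mod 4 is 1 or 3, and r^3 = r^4 = 1 also forces r = 1. *)
have r44 k : r 0 ^+ (4 * k) = 1 by rewrite exprM r4 expr1n.
move: rp; rewrite (divn_eq p 4) mulnC exprD r44 mul1r.
have : (p %% 4 < 4)%N by rewrite ltn_mod.
have : odd (p %% 4) by move: p_odd; rewrite {1}(divn_eq p 4) oddD oddM andbF.
case: (p %% 4)%N => [|[|[|[|]]]] // _ _ r3.
by move: r4; rewrite exprS r3 mulr1.
Qed.

Lemma uprod_perM x n : w (x + P * n%:R) = w x.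
Proof.
elim: n => [|n IHn]; first by rewrite mulr0 addr0.
by rewrite -natr1 mulrDr mulr1 addrA uprod_per.
Qed.

(** The factor P encodes a congruence modulo p. There, all windows of p consecutive elements have
    the same product of units, which is (p - 1)! = - 1 by Wilson's theorem. *)
Lemma mulp_uprod x : P * w x = - P.
Proof.
have [n ->] := natr_surj x; elim: n => [|n IHn]; last first.
  have := uprodS n%:R => /(congr1 ( *%R P)).
  rewrite mulrA [RHS]mulrA -{3}[P]mulr1 mulp_unit_or_1Dp [RHS]mulrAC IHn natr1.
  exact: (mulIr (unit_or_1_unit _)).
have -> : w 0 = (p.-1)`!%:R.
  rewrite /uprod; have := unit_natr; case: p (prime_gt0 p_pr) => // n _ un.
  rewrite big_ord_recl /= add0r {1}/u (un 0%N) dvdn0 mul1r.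
  rewrite fact_prod big_add1 /= big_mkord natr_prod; apply: eq_bigr => i _.
  by rewrite add0r unit_or_1_id // un gtnNdvd // ltnS ltn_ord.
have := Wilson (prime_gt1 p_pr); rewrite p_pr => /esym/dvdnP[k ek].
apply/eqP; rewrite eq_sym -subr_eq0 -opprD oppr_eq0 -[X in X + _]mulr1 -mulrDr.
by rewrite nat1r ek natrM mulrCA p_sq0 mulr0.
Qed.

(** The Taylor expansion stops at first order because P^2 = 0. *)
Lemma hornerDp (f : {poly R}) x y :
  f.[x + P * y] = f.[x] + P * y * f^`().[x].
Proof.
elim/poly_ind: f => [|f c IHf]; first by rewrite deriv0 !horner0 mulr0 addr0.
rewrite derivMXaddC !hornerE IHf.
transitivity (f.[x] * x + P * y * (f.[x] + f^`().[x] * x) + c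
  + P * P * (y * y * f^`().[x])); first by ring.
by rewrite p_sq0 mul0r addr0; ring.
Qed.

Lemma mulp_power_sum k : (k < p.-1)%N -> P * \sum_(j < p) j%:R ^+ k = 0 :> R.
Proof.
move=> /(prime_dvd_power_sum p_pr); rewrite big_mkord => /dvdnP[c ec].
have -> : \sum_(j < p) j%:R ^+ k = (\sum_(j < p) j ^ k)%:R :> R.
  by rewrite natr_sum; apply: eq_bigr => j _; rewrite natrX.
by rewrite ec natrM mulrCA p_sq0 mulr0.
Qed.

(* The coefficient of degree p - 1 of such a derivative is divisible by p,
   and the lower powers have power sums divisible by p. *)
Lemma mulp_sum_deriv (f : {poly R}) : (size f <= p.+1)%N ->
  P * \sum_(j < p) f^`().[j%:R] = 0.
Proof.
move=> sz_f; have sz_f' : (size f^`() <= p)%N.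
  apply/leq_sizeP => j lepj; rewrite coef_deriv nth_default ?mul0rn //.
  exact: leq_trans sz_f _.
under eq_bigr => j _ do rewrite (horner_coef_wide _ sz_f').
rewrite exchange_big mulr_sumr big1 // => i _.
rewrite -mulr_sumr; case: (ltnP i p.-1) => [lti|lei].
  by rewrite mulrCA mulp_power_sum ?mulr0.
have -> : nat_of_ord i = p.-1 by have := ltn_ord i; lia.
rewrite coef_deriv prednK ?prime_gt0 // mulrA.
by rewrite -(mulr_natl f`_p) mulrA p_sq0 !mul0r.
Qed.

Lemma odd_prime_sign n k : (n + k = p.-1)%N -> (-1) ^+ n * (-1) ^+ k = 1 :> R.
Proof.
move=> nk; rewrite -exprD nk -signr_odd; move: p_odd.
by case: p (prime_gt0 p_pr) => //= i _; case: odd.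
Qed.

(** In Z/p^2 this is the congruence y = 1 modulo p. *)
Definition fixes_p (y : R) := P * y = P.

Lemma fixes_p_mul x y : fixes_p x -> fixes_p y -> fixes_p (x * y).
Proof. by rewrite /fixes_p => hx hy; rewrite mulrA hx. Qed.

Lemma fixes_p_exp x n : fixes_p x -> fixes_p (x ^+ n).
Proof.
move=> hx; elim: n => [|n IHn]; first by rewrite /fixes_p mulr1.
by rewrite exprS; apply: fixes_p_mul.
Qed.

Lemma fixes_p_inv x : fixes_p x -> x \is a GRing.unit -> fixes_p x^-1.
Proof. by rewrite /fixes_p => hx Ux; rewrite -{1}hx mulrK. Qed.

(** * Functions satisfying the functional equation of Gamma_p *)

Section Gamma.
Variable g : R -> R.
Hypothesis g0 : g 0 = 1.
Hypothesis gS : forall x, g (x + 1) = - u x * g x.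

Lemma gammaDn x n : g (x + n%:R) = (-1) ^+ n * uprod n x * g x.
Proof.
elim: n => [|n IHn]; first by rewrite /uprod big_ord0 addr0 !mul1r.
rewrite -natr1 addrA gS IHn /uprod big_ord_recr /= exprS; ring.
Qed.

Lemma gamma_unit x : g x \is a GRing.unit.
Proof.
have [n ->] := natr_surj x; rewrite -[n%:R]add0r gammaDn g0 mulr1.
by rewrite unitrM uprod_unit unitrX ?unitrN1.
Qed.

Lemma gammaDp x n : g (x + P * n%:R) = (- w x) ^+ n * g x.
Proof.
elim: n => [|n IHn]; first by rewrite mulr0 addr0 mul1r.
rewrite -natr1 mulrDr mulr1 addrA gammaDn uprod_perM IHn -signr_odd p_odd exprS.
by rewrite expr1; ring.
Qed.

(** The reflection formula, squared to discard a sign that depends on [x]. A unit step in [x]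
    changes the two factors by [u (- x - 1)] and [u (x + 1)], inversely to each other up to sign. *)
Lemma gamma_reflection x : (g (- x) * g (x + 1)) ^+ 2 = 1.
Proof.
have [n ->] := natr_surj x; elim: n => [|n IHn].
  by rewrite mulr0n oppr0 gS g0 /u unitr0 mulr1 mul1r sqrrN expr1n.
have e1 : g (- n%:R) = - u (- n.+1%:R) * g (- n.+1%:R).
  by rewrite -gS -natr1; congr g; ring.
rewrite -[RHS]IHn gS natr1 e1 !exprMn !sqrrN unit_or_1_sqrN; ring.
Qed.

Lemma gamma_sqrN x : g (- x) ^+ 2 * g (x + 1) ^+ 2 = 1.
Proof. by rewrite -exprMn gamma_reflection. Qed.

Lemma gamma_natr n : (n < p)%N -> g n.+1%:R ^+ 2 = n`!%:R ^+ 2.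
Proof.
move=> ltnp; rewrite -[n.+1%:R]add0r gammaDn g0 mulr1 exprMn sqrr_sign mul1r.
congr (_ ^+ 2); rewrite /uprod big_ord_recl /= add0r {1}/u (unit_natr 0) dvdn0.
rewrite mul1r fact_prod big_add1 /= big_mkord natr_prod; apply: eq_bigr => i _.
rewrite add0r unit_or_1_id // unit_natr gtnNdvd //.
exact: leq_ltn_trans (ltn_ord i) ltnp.
Qed.

Definition shifts (n : nat) : {poly R} := \prod_(i < n) ('X + (i.+1%:R)%:P).

Lemma shiftsE n x :
  (forall i : 'I_n, x + i.+1%:R \is a GRing.unit) ->
  (shifts n).[x] = uprod n (x + 1).
Proof.
move=> Ux; rewrite horner_prod; apply: eq_bigr => i _.
by rewrite !hornerE -addrA nat1r unit_or_1_id.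
Qed.

(** Of the values j + 1, ..., j + n, all below 2p, only p is divisible by p. It comes from the
    factor with constant term p - j, and the cofactor takes at j a product of units as its value. *)
Lemma shifts_split n j : (n < p)%N -> (j < p)%N -> (p <= j + n)%N ->
  exists2 s : {poly R},
    shifts n = ('X + ((p - j)%:R)%:P) * s & s.[j%:R] = uprod n (j%:R + 1).
Proof.
move=> ltnp ltjp lepjn; have lt_i : (p - j.+1 < n)%N by lia.
pose i0 := Ordinal lt_i.
exists (\prod_(i < n | i != i0) ('X + (i.+1%:R)%:P)).
  rewrite /shifts (bigD1 i0) //=; congr (('X + _%:R%:P) * _); lia.
rewrite horner_prod /uprod [RHS](bigD1 i0) //= -addrA nat1r -natrD.
rewrite {1}/u unit_natr (_ : (j + (p - j.+1).+1 = p)%N); last by lia.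
rewrite dvdnn mul1r; apply: eq_bigr => i nei.
rewrite !hornerE -addrA nat1r -natrD unit_or_1_id // unit_natr.
apply/negP => /dvdnP[k ek]; move/eqP: nei; apply; apply: val_inj => /=.
have := ltn_ord i; case: k ek => [|[|k]]; rewrite ?mulSn; lia.
Qed.

(** * The gamma quotient of a pair of parameters and its polynomial model *)

Section Pair.
Variables (m M b : nat).
Hypothesis mM : (m + M = p.-1)%N.
Hypothesis lemM : (m <= M)%N.
Local Notation al := (P * b%:R - m%:R : R).
Local Notation be := (1 + m%:R - P * b%:R : R).

(** Here [al] and [be] stand for 1/d and 1 - 1/d in some order. The parameter [b] is a natural
    number so that [P * b%:R] amounts to [b] steps of length p, as in [gammaDp]. *)
Definition gamma_pair x := g (- x) ^+ 2 * (g (al + x) * g (be + x)).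
Definition shift_pair : {poly R} := shifts m * shifts M.
(** The value of [shift_pair] at [x], deprived of its nonunit factors. *)
Definition uprod_pair x := uprod m (x + 1) * uprod M (x + 1).
Local Notation Phi := gamma_pair.
Local Notation q := shift_pair.

(** Steps of length p carry the arguments [al + x] and [be + x] to x + 1 + M and x + 1 + m, at the
    cost of powers of - w, which are collected in [psi]. From there M and m unit steps lead down to
    x + 1, where the reflection formula cancels g (- x)^2. *)
Lemma gamma_pairE : exists psi : R -> R,
  [/\ forall x, Phi x = psi x * uprod_pair x,
      forall x n, psi (x + P * n%:R) = psi x & forall x, fixes_p (psi x)].
Proof.
pose v x := - w x.
have Uv x : v x \is a GRing.unit by rewrite unitrN uprod_unit.
have vp x n : v (x + P * n%:R) = v x by rewrite /v uprod_perM.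
have pv x : fixes_p (v x) by rewrite /fixes_p mulrN mulp_uprod opprK.
exists (fun x => v (x - m%:R) ^+ b / (v (x - m%:R) * v (x + 1 + m%:R) ^+ b)).
split=> [x|x n|x].
- have ga : g (al + x) = v (x - m%:R) ^+ b * g (x - m%:R).
    by rewrite -gammaDp; congr g; ring.
  have gb : g (x + 1 + m%:R) = v (x + 1 + m%:R) ^+ b * g (be + x).
    have -> : v (x + 1 + m%:R) = v (be + x).
      by rewrite -(vp (be + x) b); congr v; ring.
    by rewrite -gammaDp; congr g; ring.
  have gM : g (x + 1 + M%:R) = v (x - m%:R) * g (x - m%:R).
    have -> : x + 1 + M%:R = x - m%:R + P * 1%:R.
      have -> : P = m%:R + M%:R + 1.
        by rewrite -natrD natr1 mM prednK ?prime_gt0.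
      ring.
    by rewrite gammaDp.
  have gm' : g (x + 1 + m%:R) * g (x + 1 + M%:R)
      = uprod_pair x * g (x + 1) ^+ 2.
    rewrite !(gammaDn (x + 1)) /uprod_pair.
    transitivity ((-1) ^+ m * (-1) ^+ M * (uprod m (x + 1) * uprod M (x + 1)
      * g (x + 1) ^+ 2)); first by ring.
    by rewrite odd_prime_sign // mul1r.
  set A := v (x - m%:R) in ga gM *; set B := v (x + 1 + m%:R) in gb *.
  have UAB : A * B ^+ b \is a GRing.unit by rewrite unitrM unitrX ?Uv.
  apply: (mulrI UAB); rewrite [RHS]mulrA [_ * (_ / _)]mulrC divrK //.
  rewrite /gamma_pair ga.
  transitivity (A ^+ b * (g (- x) ^+ 2 * (B ^+ b * g (be + x) * (A * g (x - m%:R))))).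
    ring.
  rewrite -gb -gM gm'.
  transitivity (A ^+ b * uprod_pair x * (g (- x) ^+ 2 * g (x + 1) ^+ 2)).
    ring.
  by rewrite gamma_sqrN mulr1.
- have -> : x + P * n%:R - m%:R = x - m%:R + P * n%:R by ring.
  have -> : x + P * n%:R + 1 + m%:R = x + 1 + m%:R + P * n%:R by ring.
  by rewrite !vp.
- apply: fixes_p_mul; first exact: fixes_p_exp.
  apply: fixes_p_inv; last by rewrite unitrM unitrX ?Uv.
  by apply: fixes_p_mul => //; apply: fixes_p_exp.
Qed.

(** Every factor is congruent modulo p to a number between 1 and m + M = p - 1, hence is a unit. *)
Lemma shift_pair_small j x : (j <= m)%N ->
  q.[j%:R + P * x] = uprod_pair (j%:R + P * x).
Proof.
move=> lejm; rewrite /shift_pair hornerM !shiftsE // => i;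
  rewrite addrAC unitrDp -natrD unit_natr gtnNdvd //;
  have := ltn_ord i; have := prime_gt0 p_pr; lia.
Qed.

(** Periodicity of [psi] leaves only the first-order variation of q, and [psi] disappears from that
    term because it is multiplied by P. *)
Lemma gamma_pair_small j : (j <= m)%N ->
  Phi (j%:R + P * j%:R) = Phi j%:R + P * (j%:R * q^`().[j%:R]).
Proof.
move=> lejm; have [psi [PhiE psi_per psi_p]] := gamma_pairE.
rewrite !PhiE psi_per -shift_pair_small // hornerDp.
have := shift_pair_small 0 lejm; rewrite mulr0 addr0 => ->.
rewrite mulrDr; congr (_ + _).
rewrite -[in RHS](psi_p j%:R); ring.
Qed.

Lemma mulp_gamma_pair x n : P * Phi (x + P * n%:R) = P * uprod_pair x.
Proof.
have [psi [PhiE psi_per psi_p]] := gamma_pairE.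
rewrite PhiE mulrA psi_p /uprod_pair /uprod !mulrA.
have H k : P * \prod_(i < k) u (x + P * n%:R + 1 + i%:R)
         = P * \prod_(i < k) u (x + 1 + i%:R).
  elim: k => [|k IHk]; first by rewrite !big_ord0.
  rewrite !big_ord_recr /= !mulrA IHk mulrAC [RHS]mulrAC; congr (_ * _).
  rewrite -[RHS](mulp_unit_or_1Dp _ n%:R); congr (_ * u _); ring.
by rewrite H mulrAC H mulrAC.
Qed.

Lemma mulp_shift_pair_small j : (j <= m)%N -> P * q.[j%:R] = P * Phi j%:R.
Proof.
move=> lejm; have := mulp_gamma_pair j%:R 0; rewrite mulr0 addr0 => ->.
by have := shift_pair_small 0 lejm; rewrite mulr0 addr0 => ->.
Qed.

(** Since j + M >= p, the factor [shifts M] has a zero at j modulo p. *)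
Lemma mulp_shift_pair_large j : (m < j < p)%N -> P * q.[j%:R] = 0.
Proof.
move=> /andP[ltmj ltjp].
have [||| s es _] := @shifts_split M j; try lia.
rewrite /shift_pair es !(hornerM, hornerD, hornerX, hornerC) -natrD subnKC;
  last exact: ltnW.
by rewrite mulrCA [P * (P * _)]mulrA p_sq0 mul0r mulr0.
Qed.

(** Here j is a simple zero of q modulo p, so q' takes there the value of the cofactor, which is the
    product of the unit factors. *)
Lemma mulp_deriv_shift_pair_mid j n : (m < j <= M)%N ->
  P * q^`().[j%:R] = P * Phi (j%:R + P * n%:R).
Proof.
move=> /andP[ltmj lejM]; rewrite mulp_gamma_pair.
have [||| s es sj] := @shifts_split M j; try lia.
rewrite /shift_pair es !derivE !(hornerM, hornerD, hornerX, hornerC) -natrD subnKC;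
  last by lia.
rewrite /uprod_pair -sj -shiftsE; last first.
  move=> i; rewrite -natrD unit_natr gtnNdvd //;
    have := ltn_ord i; have := prime_gt0 p_pr; lia.
transitivity (P * ((shifts m).[j%:R] * s.[j%:R]) + P * P *
   ((shifts m)^`().[j%:R] * s.[j%:R] + (shifts m).[j%:R] * s^`().[j%:R])).
  ring.
by rewrite p_sq0 mul0r addr0.
Qed.

(** Both [shifts m] and [shifts M] vanish at j modulo p, so q has a double zero there. *)
Lemma mulp_deriv_shift_pair_large j : (M < j < p)%N -> P * q^`().[j%:R] = 0.
Proof.
move=> /andP[ltMj ltjp].
have [||| s es _] := @shifts_split M j; try lia.
have [||| t et _] := @shifts_split m j; try lia.
rewrite /shift_pair es et !derivE !(hornerM, hornerD, hornerX, hornerC) -natrD subnKC;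
  last exact: ltnW.
set S := s.[_]; set T := t.[_]; set S' := (s^`()).[_]; set T' := (t^`()).[_].
transitivity (P * P * (T * S + P * T' * S + T * S + P * T * S')); first by ring.
by rewrite p_sq0 mul0r.
Qed.

(** This is [mulp_sum_deriv] for X q, whose derivative is q + X q'. For m < j <= M the term q drops
    out and q' becomes [Phi]; for j > M both terms drop out. *)
Lemma sum_gamma_pair :
  \sum_(0 <= j < m.+1) P * (q.[j%:R] + j%:R * q^`().[j%:R])
  + \sum_(m.+1 <= j < M.+1) P * (j%:R * Phi j%:R) = 0.
Proof.
have szs n : (size (shifts n) <= n.+1)%N.
  rewrite /shifts; elim: n => [|n IHn]; first by rewrite big_ord0 size_poly1.
  rewrite big_ord_recr /=; apply: leq_trans (size_polyMleq _ _) _.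
  by rewrite size_XaddC addn2.
have sz : (size ('X * q : {poly R})%R <= p.+1)%N.
  rewrite mulrC; apply: leq_trans (size_polyMleq _ _) _; rewrite size_polyX addn2 /=.
  rewrite /shift_pair ltnS; apply: leq_trans (size_polyMleq _ _) _.
  have := szs m; have := szs M; have := prime_gt0 p_pr; lia.
rewrite -[RHS](mulp_sum_deriv sz) mulr_sumr.
rewrite -(big_mkord xpredT (fun j : nat => P * ('X * q)^`().[j%:R])).
have leMp : (M.+1 <= p)%N by have := prime_gt0 p_pr; lia.
rewrite [RHS](@big_cat_nat _ _ _ m.+1) //=; last by apply: leq_trans leMp.
rewrite [X in _ = _ + X](@big_cat_nat _ _ _ M.+1) //=.
have dE j : P * ('X * q)^`().[j%:R] = P * (q.[j%:R] + j%:R * q^`().[j%:R]).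
  by rewrite derivM derivX mul1r !(hornerM, hornerD, hornerX).
congr (_ + _); first by apply: eq_bigr => j _; rewrite dE.
rewrite [X in _ = _ + X]big_nat_cond [X in _ = _ + X]big1 => [|j]; last first.
  rewrite andbT => /andP[ltMj ltjp]; rewrite dE mulrDr.
  rewrite mulp_shift_pair_large; last by lia.
  by rewrite mulrCA mulp_deriv_shift_pair_large ?mulr0 ?addr0 //; lia.
rewrite addr0; apply: eq_big_nat => j /andP[ltmj lejM].
rewrite dE mulrDr mulp_shift_pair_large; last by lia.
rewrite add0r mulrCA -[RHS]mulrCA; congr (_ * _).
rewrite (@mulp_deriv_shift_pair_mid _ 0) ?mulr0 ?addr0 //; lia.
Qed.

End Pair.

(** * Rising factorials and products of units *)

Lemma unit_natDp x i0 i c : x + i0%:R = P * c ->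
  (i0 < p)%N -> (i < p)%N -> i != i0 -> x + i%:R \is a GRing.unit.
Proof.
move=> xE lt0 lti; have -> : x + i%:R = i%:R - i0%:R + P * c by rewrite -xE; ring.
rewrite unitrDp; case: (ltngtP i i0) => // [lt|lt] _.
  rewrite -opprB unitrN -natrB 1?ltnW // unit_natr gtnNdvd ?subn_gt0 //; lia.
by rewrite -natrB 1?ltnW // unit_natr gtnNdvd ?subn_gt0 //; lia.
Qed.

Lemma prod_natD_unit x i0 n c : x + i0%:R = P * c -> (i0 < p)%N -> (n <= i0)%N ->
  \prod_(0 <= i < n) (x + i%:R) = uprod n x.
Proof.
move=> xE lt0 len; rewrite big_mkord; apply: eq_bigr => i _.
rewrite unit_or_1_id // (unit_natDp xE) //; have := ltn_ord i; lia.
Qed.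

Lemma prod_natD_nonunit x i0 n c : x + i0%:R = P * c -> (i0 < n)%N -> (n <= p)%N ->
  \prod_(0 <= i < n) (x + i%:R) = P * c * uprod n x.
Proof.
move=> xE lt0 len; rewrite big_mkord /uprod.
rewrite (bigD1 (Ordinal lt0)) //= [in RHS](bigD1 (Ordinal lt0)) //= xE.
rewrite {1}/u -[P * c]add0r unitrDp unitr0 mul1r.
congr (_ * _); apply: eq_bigr => i nei.
rewrite unit_or_1_id // (unit_natDp xE) //; have := ltn_ord i; lia.
Qed.

Lemma mulp_sub1V : - 1 / (P - 1) = 1 + P /\ (P - 1)^-1 = - (1 + P).
Proof.
have e : (- (1 + P)) * (P - 1) = 1.
  transitivity (1 - P * P); first by ring.
  by rewrite p_sq0 subr0.
have U : P - 1 \is a GRing.unit by apply/unitrPr; exists (- (1 + P)); rewrite mulrC.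
have -> : (P - 1)^-1 = - (1 + P) by apply: (mulIr U); rewrite mulVr.
by rewrite mulN1r opprK.
Qed.

(** * The congruence in the abstract ring *)

Section Congruence.
Variables (a : R) (m M L : nat).
Hypothesis mM : (m + M = p.-1)%N.
Hypothesis lemM : (m <= M)%N.
Hypothesis lemL : (m <= L)%N.
(** For a = 1/d the alternatives are p = 1 and p = - 1 modulo d. They tell which of a, 1 - a is
    congruent to - m modulo p. *)
Hypothesis aE : (a = P * a - m%:R /\ L = M) \/ (1 - a = P * a - m%:R /\ L.+1 = M).

Local Notation J := (fun j : nat => j%:R / (P - 1) : R).
Local Notation Psi := (fun x : R => g (- x) ^+ 2 * (g (a + x) * g (1 - a + x))).

(** The rising factorial of the parameter congruent to - m acquires the nonunit factor P a once n >
    m, and the other one acquires P (1 - a) once n > M. Both together give P^2 = 0. *)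
Lemma hypergeom_term_gamma n : (n < p)%N ->
  g a * g (1 - a) * ((\prod_(0 <= i < n) (a + i%:R)) *
    (\prod_(0 <= i < n) (1 - a + i%:R)) / n`!%:R ^+ 2)
  = if (n <= m)%N then Psi n%:R else if (n <= M)%N then P * a * Psi n%:R else 0.
Proof.
move=> ltnp.
have p_gt0 := prime_gt0 p_pr.
(* Both factorials in the denominator become gamma values through the reflection formula. *)
have fE : (n`!%:R ^+ 2)^-1 = g (- n%:R) ^+ 2.
  rewrite -gamma_natr //; apply: (@mulIr _ (g n.+1%:R ^+ 2)).
    by rewrite unitrX ?gamma_unit.
  by rewrite mulVr ?unitrX ?gamma_unit // -natr1 gamma_sqrN.
pose F x y := g x * g y * ((\prod_(0 <= i < n) (x + i%:R)) *
    (\prod_(0 <= i < n) (y + i%:R))).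
pose G x y := g (x + n%:R) * g (y + n%:R).
have GE x y : G x y = uprod n x * uprod n y * (g x * g y).
  rewrite /G !gammaDn.
  transitivity ((-1) ^+ n ^+ 2 * (uprod n x * uprod n y * (g x * g y))); first by ring.
  by rewrite sqrr_sign mul1r.
(* Whichever alternative of [aE] holds, [x] is the parameter congruent to - m and [y] the one
   congruent to - M. *)
suff main x y : x + m%:R = P * a -> y + M%:R = P * (1 - a) ->
   F x y = if (n <= m)%N then G x y else if (n <= M)%N then P * a * G x y else 0.
  rewrite fE mulrA -/(F a (1 - a)) mulrC.
  suff -> : F a (1 - a) = if (n <= m)%N then G a (1 - a)
      else if (n <= M)%N then P * a * G a (1 - a) else 0.
    by case: ifP => // _; case: ifP => _; rewrite ?mulr0 // mulrCA.
  have PmM : P = m%:R + M%:R + 1 by rewrite -natrD natr1 mM prednK.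
  case: aE => [[ha _]|[ha _]].
    apply: main; first by rewrite {1}ha; ring.
    rewrite {1}ha PmM; ring.
  have -> : F a (1 - a) = F (1 - a) a by rewrite /F [g a * _]mulrC [X in _ * X]mulrC.
  have -> : G a (1 - a) = G (1 - a) a by rewrite /G mulrC.
  apply: main; first by rewrite ha; ring.
  have -> : a + M%:R = 1 + M%:R - (1 - a) by ring.
  by rewrite [X in _ - X]ha PmM; ring.
move=> xE yE.
have ltmp : (m < p)%N by lia.
have ltMp : (M < p)%N by lia.
rewrite GE /F; case: leqP => [lenm|ltmn].
  rewrite (prod_natD_unit xE) // (prod_natD_unit yE) //; last exact: leq_trans lemM.
  by rewrite mulrC.
rewrite (prod_natD_nonunit xE) //; last exact: ltnW.
case: leqP => [lenM|ltMn]; first by rewrite (prod_natD_unit yE) //; ring.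
rewrite (prod_natD_nonunit yE) //; last exact: ltnW.
transitivity (P * P * (g x * g y * (a * uprod n x * ((1 - a) * uprod n y)))).
  by ring.
by rewrite p_sq0 mul0r.
Qed.

(** After multiplication by the unit g a * g (1 - a), the difference of the sides is the sum in
    [sum_gamma_pair]. The prefactor 1 + P contributes P q(j) and [gamma_pair_small] contributes P j
    q'(j) for j <= m; the middle range contributes P j Psi(j) beyond the hypergeometric terms P a
    Psi(j). *)
Lemma gamma_hypergeom_congr :
  - 1 / (P - 1) * (
    \sum_(0 <= j < m.+1) g (J j) ^+ 2 *
       (g (a - J j) / g a * (g (1 - a - J j) / g (1 - a)))
    + - P * \sum_(m.+1 <= j < L.+1) g (J j) ^+ 2 *
       (g (1 - a - J j) / g (1 - a)) * (g (1 + a - J j) / g a))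
  = \sum_(0 <= n < p) (\prod_(0 <= i < n) (a + i%:R)) *
      (\prod_(0 <= i < n) (1 - a + i%:R)) / n`!%:R ^+ 2.
Proof.
have p_gt0 := prime_gt0 p_pr.
have PmM : P = m%:R + M%:R + 1 by rewrite -natrD natr1 mM prednK.
have [b bE] := natr_surj a.
pose x (j : nat) : R := j%:R + P * j%:R.
have JE j : J j = - x j by rewrite (proj2 mulp_sub1V) /x; ring.
have PsiE y : gamma_pair m b y = Psi y.
  rewrite /gamma_pair -bE; case: aE => -[ha _].
    by rewrite -ha; congr (_ * (_ * g _)); rewrite {2}ha; ring.
  rewrite -ha [g _ * g _]mulrC; congr (_ * (g _ * _)).
  transitivity (1 - (P * a - m%:R) + y); first by ring.
  by rewrite -ha; ring.
have PPsi y n : P * Psi (y + P * n%:R) = P * Psi y.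
  have := mulp_gamma_pair b mM y 0; rewrite mulr0 addr0 -!PsiE => ->.
  exact: mulp_gamma_pair.
have aM : 1 - a = P * a - m%:R -> a + M%:R = P * (1 - a).
  move=> ha; have -> : a + M%:R = 1 + M%:R - (1 - a) by ring.
  by rewrite [X in _ - X]ha PmM; ring.
set eps := g a * g (1 - a).
have Ueps : eps \is a GRing.unit by rewrite unitrM !gamma_unit.
apply: (mulrI Ueps); rewrite [RHS]mulr_sumr.
have leMp : (M.+1 <= p)%N by lia.
transitivity (\sum_(0 <= j < m.+1) Psi j%:R
            + \sum_(m.+1 <= j < M.+1) P * a * Psi j%:R); last first.
  rewrite [RHS](@big_cat_nat _ _ _ m.+1) //=; last by lia.
  rewrite [X in _ = _ + X](@big_cat_nat _ _ _ M.+1) //=.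
  congr (_ + _).
    apply: eq_big_nat => j /andP[_ lej]; rewrite hypergeom_term_gamma; last by lia.
    by rewrite -ltnS lej.
  rewrite [X in _ = _ + X]big_nat_cond [X in _ = _ + X]big1 => [|j]; last first.
    rewrite andbT => /andP[ltMj ltjp]; rewrite hypergeom_term_gamma //.
    by rewrite leqNgt (leq_ltn_trans lemM) //= leqNgt ltMj.
  rewrite addr0; apply: eq_big_nat => j /andP[ltmj lej].
  rewrite hypergeom_term_gamma; last by lia.
  by rewrite leqNgt ltmj /= -ltnS lej.
rewrite (proj1 mulp_sub1V) mulrCA mulrDr.
have -> : eps * \sum_(0 <= j < m.+1) g (J j) ^+ 2 *
       (g (a - J j) / g a * (g (1 - a - J j) / g (1 - a)))
    = \sum_(0 <= j < m.+1) (Psi j%:R + P * (j%:R * (shift_pair m M)^`().[j%:R])).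
  rewrite mulr_sumr; apply: eq_big_nat => j /andP[_ lej].
  have := gamma_pair_small b mM lemM lej; rewrite !PsiE JE !opprK => <-.
  rewrite -/(x j) /eps.
  transitivity (g (- x j) ^+ 2 * (g (a + x j) * (g a / g a) *
     (g (1 - a + x j) * (g (1 - a) / g (1 - a))))); first by ring.
  by rewrite !mulrV ?gamma_unit // !mulr1.
have -> : eps * (- P * \sum_(m.+1 <= j < L.+1) g (J j) ^+ 2 *
       (g (1 - a - J j) / g (1 - a)) * (g (1 + a - J j) / g a))
    = \sum_(m.+1 <= j < M.+1) P * ((a + j%:R) * Psi j%:R).
  transitivity (\sum_(m.+1 <= j < L.+1) P * ((a + j%:R) * Psi j%:R)).
    rewrite !mulr_sumr; apply: eq_big_nat => j /andP[ltmj lejL].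
    (* The argument 1 + a calls for one use of the functional equation. Its factor is a + j modulo
       p, because the only index below p with a + j a nonunit is m or L + 1 = M, outside the
       range. *)
    rewrite JE !opprK; have -> : 1 + a + x j = a + x j + 1 by ring.
    rewrite gS; transitivity (u (a + x j) * (P * Psi (x j)) *
       ((g a / g a) * (g (1 - a) / g (1 - a)))); first by rewrite /eps; ring.
    rewrite !mulrV ?gamma_unit // !mulr1 PPsi.
    suff e : P * u (a + x j) = P * (a + j%:R).
      transitivity (P * u (a + x j) * Psi j%:R); first by ring.
      by rewrite e; ring.
    rewrite /x addrA mulp_unit_or_1Dp unit_or_1_id //.
    case: aE => -[ha LE].
      apply: (@unit_natDp _ m _ a); [rewrite {1}ha; ring | lia..].
    apply: (@unit_natDp _ M _ (1 - a)); [exact: aM|lia..].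
  case: aE => -[ha LE]; first by rewrite LE.
  (* When L + 1 = M, the additional term j = M is zero: a + M is a multiple of P. *)
  rewrite -[in RHS]LE [RHS]big_nat_recr /=; last by lia.
  rewrite LE aM // -[LHS]addr0; congr (_ + _).
  by rewrite !mulrA p_sq0 !mul0r.
have := sum_gamma_pair b mM lemM; set S2 := \sum_(m.+1 <= j < M.+1) _.
move/eqP; rewrite addr_eq0 => /eqP S1E.
have S2E : S2 = \sum_(m.+1 <= j < M.+1) P * (j%:R * Psi j%:R).
  by apply: eq_bigr => j _; rewrite PsiE.
transitivity (\sum_(0 <= j < m.+1) (Psi j%:R +
    P * ((shift_pair m M).[j%:R] + j%:R * (shift_pair m M)^`().[j%:R]))
  + \sum_(m.+1 <= j < M.+1) P * ((a + j%:R) * Psi j%:R)).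
  rewrite mulrDr; congr (_ + _); rewrite mulr_sumr.
    apply: eq_big_nat => j /andP[_ lej].
    rewrite [P * (_ + _)]mulrDr (@mulp_shift_pair_small m M b) // PsiE.
    transitivity (Psi j%:R + (P * Psi j%:R
       + P * (j%:R * (shift_pair m M)^`().[j%:R]))
       + P * P * (j%:R * (shift_pair m M)^`().[j%:R])); first by ring.
    by rewrite p_sq0 mul0r addr0.
  by apply: eq_bigr => j _; rewrite mulrDl mul1r [P * (P * _)]mulrA p_sq0 mul0r addr0.
rewrite big_split /= S1E S2E -addrA; congr (_ + _); rewrite addrC -sumrB.
by apply: eq_bigr => j _; ring.
Qed.

End Congruence.
End Gamma.
End LocalSquareZero.

(** * Wilson's theorem modulo prime powers *)

Section SquareZeroPowers.
Variables (R : comNzRingType) (p : nat) (y : R).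
Hypothesis y_sq0 : y * y = 0.
Hypothesis p_y : p%:R * y = 0.

Lemma exprD_sq0 (x : R) n : (x + y) ^+ n = x ^+ n + n%:R * x ^+ n.-1 * y.
Proof.
case: n => [|n]; first by rewrite !mul0r addr0.
elim: n => [|n IHn]; first by rewrite !mul1r.
rewrite exprS IHn /= !exprS -[in RHS]natr1.
transitivity (x * (x * x ^+ n) + (n.+1%:R + 1) * (x * x ^+ n) * y
   + n.+1%:R * x ^+ n * (y * y)); first by ring.
by rewrite y_sq0 mulr0 addr0.
Qed.

Lemma exprD_char (x : R) : (x + y) ^+ p = x ^+ p.
Proof. by rewrite exprD_sq0 mulrAC p_y mul0r addr0. Qed.

Lemma prod_natM_sq0 (x : R) n :
  \prod_(0 <= b < n) (x + b%:R * y) = x ^+ n + 'C(n, 2)%:R * x ^+ n.-1 * y.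
Proof.
elim: n => [|n IHn]; first by rewrite big_nil !mul0r addr0.
rewrite big_nat_recr //= IHn binS bin1 natrD.
case: n {IHn} => [|n] /=; first by rewrite bin0n /= !(mul0r, addr0) mul1r.
rewrite !exprS.
transitivity (x * (x * x ^+ n) + ('C(n.+1, 2)%:R + n.+1%:R) * (x * x ^+ n) * y
  + 'C(n.+1, 2)%:R * n.+1%:R * x ^+ n * (y * y)); first by ring.
by rewrite y_sq0 mulr0 addr0.
Qed.

(** The linear term has coefficient p (p - 1) / 2, a multiple of p since p is odd. *)
Lemma prod_natM_char (x : R) : prime p -> odd p ->
  \prod_(0 <= b < p) (x + b%:R * y) = x ^+ p.
Proof.
move=> p_pr p_odd; rewrite prod_natM_sq0.
have /dvdnP[c ->] : (p %| 'C(p, 2))%N.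
  apply: prime_dvd_bin => //=; case: p p_pr p_odd => [|[|[|]]] //.
rewrite natrM -!mulrA [p%:R * _]mulrCA p_y !mulr0 addr0 //.
Qed.

End SquareZeroPowers.

Section ZmodPrimePower.
Variable p : nat.
Hypothesis p_pr : prime p.
Local Notation Z n := 'Z_(p ^ n.+1).

Lemma natr_Zpow_eq0 n a : ((a%:R : Z n) == 0) = (p ^ n.+1 %| a)%N.
Proof.
by rewrite -val_eqE /= val_Zp_nat ?padic_modulus_gt1.
Qed.

Lemma eq_natr_Zpow n a b : ((a%:R : Z n) == b%:R) = (a == b %[mod p ^ n.+1])%N.
Proof. by rewrite -val_eqE /= !val_Zp_nat ?padic_modulus_gt1. Qed.

Lemma unit_natr_Zpow n a : ((a%:R : Z n) \is a GRing.unit) = ~~ (p %| a)%N.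
Proof.
by rewrite unitZpE ?padic_modulus_gt1 // coprime_pexpl // prime_coprime.
Qed.

Lemma Zpow_sq0 n : let y : Z n.+1 := (p ^ n.+1)%:R in y * y = 0 /\ p%:R * y = 0.
Proof.
split; apply/eqP; rewrite -natrM natr_Zpow_eq0.
  by rewrite -expnD dvdn_exp2l //; lia.
by rewrite -expnS.
Qed.

(** Each p-th power improves a congruence modulo p^(n+1) to one modulo p^(n+2), since the linear
    term of the expansion gains a factor p. *)
Lemma dvdn_exp_lift n a b : (a = b %[mod p])%N ->
  (a ^ (p ^ n) = b ^ (p ^ n) %[mod p ^ n.+1])%N.
Proof.
move=> eab; elim: n => [|n IHn]; first by rewrite expn1 !expn0 !expn1.
suff lift c e : (c = e %[mod p ^ n.+1])%N -> (c ^ p = e ^ p %[mod p ^ n.+2])%N.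
  by rewrite [(p ^ n.+1)%N]expnSr !expnM; apply: lift.
move=> ece; apply/eqP; rewrite -eq_natr_Zpow; apply/eqP.
have [y2 py] := Zpow_sq0 n.
have H f : (f%:R : Z n.+1) ^+ p = (f %% p ^ n.+1)%:R ^+ p.
  rewrite {1}(divn_eq f (p ^ n.+1)) natrD natrM addrC.
  apply: exprD_char; first by rewrite mulrACA y2 mulr0.
  by rewrite mulrCA py mulr0.
by rewrite !natrX H [RHS]H ece.
Qed.

Hypothesis p_odd : odd p.

(** In the induction step the indices are i + b p^(n+1) with b < p, and the p lifts of a unit i
    multiply to i^p. The whole product is thus the p-th power of an element congruent to - 1 modulo
    p^(n+1), which is - 1. *)
Lemma Wilson_prime_power n :
  (p ^ n.+1 %| (\prod_(0 <= j < p ^ n.+1 | ~~ (p %| j)) j).+1)%N.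
Proof.
elim: n => [|n IHn].
  rewrite expn1; suff -> : (\prod_(0 <= j < p | ~~ (p %| j)) j = p.-1`!)%N.
    by rewrite -Wilson ?prime_gt1.
  rewrite fact_prod big_ltn_cond ?prime_gt0 //= dvdn0 /= prednK ?prime_gt0 //.
  rewrite big_nat_cond [RHS]big_nat_cond.
  apply: eq_bigl => j; case: (ltnP 0 j) => //= j_gt0; case: ltnP => //= ltjp.
  by rewrite gtnNdvd.
have [y2 py] := Zpow_sq0 n; set k := (p ^ n.+1)%N in y2 py IHn.
pose F (j : nat) : Z n.+1 := if (p %| j)%N then 1 else j%:R.
have FE m : (\prod_(0 <= j < m | ~~ (p %| j)%N) j)%:R = \prod_(0 <= j < m) F j.
  rewrite natr_prod big_mkcond; apply: eq_bigr => j _; rewrite /F.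
  by case: (p %| j)%N.
have Feq m1 m2 : m1 = m2 ->
  \prod_(0 <= j < m1) F j = \prod_(0 <= j < m2) F j by move=> ->.
rewrite -natr_Zpow_eq0 -natr1 FE (Feq _ _ (expnS p n.+1)) -/k big_nat_mul.
have Fk i : \prod_(0 <= b < p) F (i + b * k)%N = F i ^+ p.
  rewrite /F; have dv b : (p %| i + b * k = (p %| i))%N.
    by rewrite dvdn_addl // dvdn_mull // /k expnS dvdn_mulr.
  under eq_bigr => b _ do rewrite dv natrD natrM.
  case: ifP => _; first by rewrite big1 // expr1n.
  exact: prod_natM_char.
have -> : \prod_(0 <= b < p) \prod_(b * k <= j < b.+1 * k) F j
    = (\prod_(0 <= i < k) F i) ^+ p.
  under eq_bigr => b _ do rewrite -[X in index_iota X]add0n big_addn mulSn addnK.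
  by rewrite exchange_big /= -prodrXl; apply: eq_bigr => i _; apply: Fk.
rewrite -FE; move/dvdnP: IHn => [c ec].
have -> : (\prod_(0 <= j < k | ~~ (p %| j)%N) j)%:R = -1 + c%:R * k%:R :> Z n.+1.
  by rewrite -natrM -ec -natr1; ring.
rewrite exprD_char; first by rewrite -signr_odd p_odd expr1 addNr.
  by rewrite mulrACA y2 mulr0.
by rewrite mulrCA py mulr0.
Qed.

End ZmodPrimePower.

(** * Gamma_p at natural numbers, with values in any ring *)

Section GammaNat.
Variables (R : comNzRingType) (p : nat).

Definition gamma_nat (n : nat) : R :=
  (-1) ^+ n * \prod_(0 <= j < n | ~~ (p %| j)%N) j%:R.

Lemma gamma_natS n :
  gamma_nat n.+1 = - (if (p %| n)%N then 1 else n%:R) * gamma_nat n.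
Proof.
rewrite /gamma_nat big_mkcond big_nat_recr //= -big_mkcond exprS.
by case: (p %| n)%N => /=; ring.
Qed.

(** The generalized Wilson theorem gives the value 1 at p^(k+1), the odd sign cancelling the - 1;
    the recurrence then propagates the period. *)
Lemma gamma_nat_per k : prime p -> odd p -> (p ^ k.+1)%:R = 0 :> R ->
  forall m n, (m = n %[mod p ^ k.+1])%N -> gamma_nat m = gamma_nat n.
Proof.
move=> p_pr p_odd R0.
have per n : gamma_nat (n + p ^ k.+1)%N = gamma_nat n.
  elim: n => [|n IHn]; last first.
    by rewrite addSn !gamma_natS IHn natrD R0 addr0 dvdn_addl // expnS dvdn_mulr.
  rewrite /gamma_nat add0n -signr_odd oddX p_odd orbT big_nil expr1 mulr1 expr0.
  have /dvdnP[c /(congr1 (fun n => n%:R : R))] := Wilson_prime_power p_pr p_odd k.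
  rewrite natrM R0 mulr0 -natr1 natr_prod => /eqP; rewrite addr_eq0 => /eqP ->.
  by rewrite mulrNN mulr1.
have perM n c : gamma_nat (n + c * p ^ k.+1)%N = gamma_nat n.
  by elim: c => [|c IHc]; rewrite ?addn0 // mulSn addnCA addnC per.
move=> m n emn; rewrite (divn_eq m (p ^ k.+1)) (divn_eq n (p ^ k.+1)) emn.
by rewrite ![(_ + n %% _)%N]addnC !perM.
Qed.

End GammaNat.

(** * Reduction of p-adic integers *)

Section PadicReduction.
Variables (p : nat) (p_pr : prime p).
Local Notation Zp := (padic_int p_pr).
Local Notation Z n := 'Z_(p ^ n.+1).

(** The index is one less than the exponent: reduction modulo p^2 is [padic_proj 1]. *)
Definition padic_proj n (x : Zp) : Z n := x n.

Lemma padic_proj_zmod n : zmod_morphism (padic_proj n).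
Proof. by []. Qed.

Lemma padic_proj_monoid n : monoid_morphism (padic_proj n).
Proof. by []. Qed.

HB.instance Definition _ n :=
  GRing.isZmodMorphism.Build Zp (Z n) (padic_proj n) (padic_proj_zmod n).
HB.instance Definition _ n :=
  GRing.isMonoidMorphism.Build Zp (Z n) (padic_proj n) (padic_proj_monoid n).

Lemma natr_Zpow n (a : Z n) : (a : nat)%:R = a.
Proof. exact: natr_Zp. Qed.

Lemma natr_Zpow_val n a : (((a%:R : Z n.+1) : nat)%:R : Z n) = a%:R.
Proof.
apply/eqP; rewrite eq_natr_Zpow // val_Zp_nat ?padic_modulus_gt1 //.
by rewrite modn_dvdm // dvdn_exp2l.
Qed.

Lemma padic_projS n x : ((padic_proj n.+1 x : nat)%:R : Z n) = padic_proj n x.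
Proof.
apply: val_inj; rewrite /= val_Zp_nat ?padic_modulus_gt1 //; exact: padicP.
Qed.

Lemma padic_proj_le m n x : (m <= n)%N ->
  ((padic_proj n x : nat)%:R : Z m) = padic_proj m x.
Proof.
move=> /subnK <-; elim: (n - m)%N => [|k IHk]; first exact: natr_Zpow.
rewrite -IHk; apply/eqP; rewrite eq_natr_Zpow // -[padic_proj (k + m) x]padic_projS.
rewrite val_Zp_nat ?padic_modulus_gt1 // modn_dvdm // dvdn_exp2l //; lia.
Qed.

Lemma eq_padic_proj x y : (forall n, padic_proj n x = padic_proj n y) -> x = y.
Proof. exact: eq_padic. Qed.

Lemma padic_of_family (f : forall n, Z n) :
  (forall n, ((f n.+1 : nat)%:R : Z n) = f n) ->
  exists x : Zp, forall n, padic_proj n x = f n.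
Proof.
move=> fP; suff cf : `[< padic_coherent f >] by exists (PadicInt p_pr cf).
by apply/asboolP => n; rewrite -[in RHS]fP val_Zp_nat ?padic_modulus_gt1.
Qed.

Lemma padic_eqmodP N (x y : Zp) :
  padic_eqmod N.+1 x y <-> padic_proj N x = padic_proj N y.
Proof.
split=> [[z e]|exy].
  apply/eqP; rewrite -subr_eq0 -rmorphB e rmorphM rmorphXn rmorph_nat /=.
  by rewrite -natrX (eqP (_ : (p ^ N.+1)%:R == 0)) ?mul0r // natr_Zpow_eq0.
set d := x - y; pose D k : nat := padic_proj k d.
have D_dvd k : (N <= k)%N -> (p ^ N.+1 %| D k)%N.
  move=> leNk; rewrite -natr_Zpow_eq0 // padic_proj_le //.
  by rewrite /d rmorphB /= exy subrr.
have DS k : (D k.+1 = D k %[mod p ^ k.+1])%N.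
  by apply/eqP; rewrite -eq_natr_Zpow // padic_projS natr_Zpow.
(* Dividing by p^(N+1) loses N + 1 digits, so component n of the quotient is read off component n +
   N + 1 of the difference. *)
have [n|z zE] := @padic_of_family
    (fun n => (D (n + N.+1)%N %/ p ^ N.+1)%:R); last first.
  exists z; apply: eq_padic_proj => n; rewrite rmorphM rmorphXn rmorph_nat /= zE.
  rewrite -natrX -natrM mulnC divnK ?D_dvd //; last by lia.
  by rewrite padic_proj_le //; lia.
rewrite natr_Zpow_val; apply/eqP; rewrite eq_natr_Zpow //.
have pN : (0 < p ^ N.+1)%N by rewrite expn_gt0 prime_gt0.
rewrite -(eqn_pmul2l pN) !muln_modr -expnD ![(p ^ N.+1 * (_ %/ _))%N]mulnC.
rewrite !divnK ?D_dvd //; try by lia.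
rewrite (_ : (N.+1 + n.+1 = (n + N.+1).+1)%N); last by lia.
by apply/eqP; apply: DS.
Qed.

Lemma padic_eqmod0 (x y : Zp) : padic_eqmod 0 x y.
Proof. by exists (x - y); rewrite mul1r. Qed.

Lemma padic_proj_unit n x : (padic_proj n x \is a GRing.unit)
  = (padic_proj 0 x \is a GRing.unit).
Proof.
rewrite -(natr_Zpow (padic_proj n x)) -(padic_proj_le x (leq0n n)).
by rewrite !unit_natr_Zpow.
Qed.

Lemma padic_unit_of_proj (x : Zp) n :
  padic_proj n x \is a GRing.unit -> x \is a GRing.unit.
Proof.
rewrite padic_proj_unit => Ux.
have Un k : padic_proj k x \is a GRing.unit by rewrite padic_proj_unit.
have [k|z zE] := @padic_of_family (fun k => (padic_proj k x)^-1).
  have e (a : Z k.+1) : a \is a GRing.unit ->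
      ((a : nat)%:R : Z k) * ((a^-1 : Z k.+1) : nat)%:R = 1.
    move=> Ua; rewrite -natrM -natr_Zpow_val natrM !natr_Zpow mulrV //.
  by apply: (mulrI (Un k)); rewrite mulrV ?Un //;
    have := e _ (Un k.+1); rewrite padic_projS.
apply/unitrPr; exists z; apply: eq_padic_proj => k.
by rewrite rmorphM rmorph1 /= zE mulrV ?Un.
Qed.

Lemma padic_natr_unit n : ~~ (p %| n)%N -> (n%:R : Zp) \is a GRing.unit.
Proof.
by move=> pn; apply: (@padic_unit_of_proj _ 0); rewrite rmorph_nat unit_natr_Zpow.
Qed.

Lemma is_teichmuller_teichmuller : is_teichmuller (teichmuller p_pr).
Proof.
rewrite /teichmuller; case: xgetP => // noT; exfalso.
(* The lift of x is the limit of x^(p^n); Fermat's little theorem makes these powers coherent. *)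
have wP (x : 'F_p) : exists z : Zp, forall n, padic_proj n z = ((x : nat) ^ (p ^ n))%:R.
  apply: padic_of_family => n; rewrite natr_Zpow_val.
  apply/eqP; rewrite eq_natr_Zpow //; apply/eqP.
  have -> : ((x : nat) ^ (p ^ n.+1) = (x ^ p) ^ (p ^ n))%N by rewrite expnS expnM.
  exact/dvdn_exp_lift/fermat_little.
have [w wE] := choice wP.
apply: (noT [ffun x => w x]); split; rewrite ?ffunE.
- apply: eq_padic_proj => n; rewrite wE /=.
  by rewrite exp0n ?expn_gt0 ?prime_gt0.
- apply: eq_padic_proj => n; rewrite wE /=.
  by rewrite modn_small ?exp1n // Fp_cast // prime_gt1.
- move=> x y; rewrite !ffunE; apply: eq_padic_proj => n.
  have -> : padic_proj n (w x * w y) = padic_proj n (w x) * padic_proj n (w y) by [].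
  rewrite !wE -natrM -expnMn; apply/eqP; rewrite eq_natr_Zpow //.
  apply/eqP/dvdn_exp_lift => //=; move: (x : nat) (y : nat) => a b.
  by rewrite Fp_cast // modn_mod.
move=> x; rewrite ffunE; apply/padic_eqmodP.
by rewrite wE rmorph_nat [(p ^ 0)%N]expn0 [((x : nat) ^ 1)%N]expn1.
Qed.

Lemma teichmullerN1_sqr : teichmuller p_pr (-1) ^+ 2 = 1.
Proof.
have [_ w1 wM _] := is_teichmuller_teichmuller.
by rewrite expr2 -wM mulrNN mulr1.
Qed.

Hypothesis p_odd : odd p.

Lemma padic_proj_gamma_nat n m :
  padic_proj n (padic_gamma_nat p_pr m) = gamma_nat (Z n) p m.
Proof.
rewrite /padic_gamma_nat rmorphM rmorphXn rmorphN1 rmorph_prod; congr (_ * _).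
by apply: eq_bigr => j _; rewrite rmorph_nat.
Qed.

Lemma gamma_nat_Zpow n i j : (i = j %[mod p ^ n.+1])%N ->
  gamma_nat (Z n) p i = gamma_nat (Z n) p j.
Proof.
apply: gamma_nat_per => //; apply/eqP; by rewrite natr_Zpow_eq0.
Qed.

(** By periodicity the values of [gamma_nat] at the residues of [x] form a coherent family; the
    limit it defines rules out the default value of [xget]. *)
Lemma padic_gamma_lim (x : Zp) :
  padic_lim_nat (padic_gamma_nat p_pr) x (padic_gamma x).
Proof.
rewrite /padic_gamma; case: xgetP => [z _ //|noL]; exfalso.
have [n|l lE] := @padic_of_family (fun n => gamma_nat (Z n) p (padic_proj n x)).
  rewrite -padic_proj_gamma_nat padic_projS padic_proj_gamma_nat.
  by apply: gamma_nat_Zpow; apply/eqP; rewrite -eq_natr_Zpow // padic_projS natr_Zpow.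
apply: (noL l) => -[|N]; first by exists 0%N => n _; apply: padic_eqmod0.
exists N.+1 => n /padic_eqmodP; rewrite rmorph_nat => nx; apply/padic_eqmodP.
rewrite lE padic_proj_gamma_nat; apply: gamma_nat_Zpow.
by apply/eqP; rewrite -eq_natr_Zpow // nx natr_Zpow.
Qed.

Lemma padic_proj_gamma n (x : Zp) :
  padic_proj n (padic_gamma x) = gamma_nat (Z n) p (padic_proj n x).
Proof.
have [M MP] := padic_gamma_lim x n.+1.
(* A natural number close enough to [x] for the limit, and with the same residue modulo p^(n+1). *)
pose k : nat := padic_proj (maxn M n) x.
have xk i : (i <= maxn M n)%N -> padic_proj i (k%:R) = padic_proj i x.
  by move=> le_i; rewrite rmorph_nat padic_proj_le.
have /MP/padic_eqmodP <- : padic_eqmod M k%:R x.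
  case: (M) xk => [|N] xk; first exact: padic_eqmod0.
  by apply/padic_eqmodP/xk; rewrite leq_max ltnW.
rewrite padic_proj_gamma_nat; apply: gamma_nat_Zpow.
by apply/eqP; rewrite -eq_natr_Zpow // natr_Zpow -xk ?leq_maxr // rmorph_nat.
Qed.

End PadicReduction.

Arguments padic_proj {p p_pr} n x : simpl never.

(** * Rational numbers in commutative rings *)

Section RationalValue.
Variable R : comUnitRingType.

(* [ratr] is compatible with sums and products only on the rationals whose
   denominator is a unit of R; the relation is restricted to those. *)
Definition rat_value (q : rat) (x : R) : Prop :=
  exists n m : int, [/\ m%:~R \is a @GRing.unit R, q = n%:~R / m%:~R
    & x = n%:~R / m%:~R].

Lemma rat_value_ratr q x : rat_value q x -> ratr q = x.
Proof.
move=> [n [m [Um qE ->]]].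
have m0 : m != 0 by apply: contraTneq Um => ->; rewrite unitr0.
have e : numq q * m = n * denq q.
  apply/eqP; rewrite -(eqr_int rat) !intrM numqE {1}qE.
  by rewrite mulrAC divfK ?intr_eq0.
(* The reduced denominator, which [ratr] inverts, divides [m] and is therefore a unit. *)
have /dvdzP[c cE] : (denq q %| m)%Z.
  rewrite -(@Gauss_dvdzr _ (numq q)) ?e ?dvdz_mull //.
  by rewrite coprimez_sym; apply: coprime_num_den.
have Ud : (denq q)%:~R \is a @GRing.unit R.
  by move: Um; rewrite cE intrM unitrM => /andP[].
apply: (mulIr Ud); rewrite /ratr divrK // mulrAC; apply: (mulIr Um).
by rewrite divrK // -!intrM e.
Qed.

Lemma rat_value_int (n : int) : rat_value n%:~R n%:~R.
Proof. by exists n, 1; rewrite unitr1 !invr1 !mulr1. Qed.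

Lemma rat_value_nat n : rat_value n%:R n%:R.
Proof. exact: (rat_value_int n). Qed.

Lemma rat_valueD q1 q2 x1 x2 : rat_value q1 x1 -> rat_value q2 x2 ->
  rat_value (q1 + q2) (x1 + x2).
Proof.
move=> [n1 [m1 [U1 -> ->]]] [n2 [m2 [U2 -> ->]]].
have m1_neq0 : m1 != 0 by apply: contraTneq U1 => ->; rewrite unitr0.
have m2_neq0 : m2 != 0 by apply: contraTneq U2 => ->; rewrite unitr0.
exists (n1 * m2 + n2 * m1), (m1 * m2); split.
- by rewrite intrM unitrM U1.
- by rewrite intrD !intrM addf_div ?intr_eq0.
- have U12 : m1%:~R * m2%:~R \is a @GRing.unit R by rewrite unitrM U1.
  rewrite intrD !intrM; apply: (mulIr U12); rewrite divrK //.
  transitivity (n1%:~R * (m1%:~R / m1%:~R) * m2%:~R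
    + n2%:~R * (m2%:~R / m2%:~R) * m1%:~R : R); first by ring.
  by rewrite !divrr // !mulr1.
Qed.

Lemma rat_valueM q1 q2 x1 x2 : rat_value q1 x1 -> rat_value q2 x2 ->
  rat_value (q1 * q2) (x1 * x2).
Proof.
move=> [n1 [m1 [U1 -> ->]]] [n2 [m2 [U2 -> ->]]].
exists (n1 * n2), (m1 * m2); rewrite !intrM; split.
- by rewrite unitrM U1.
- by rewrite mulf_div.
- by rewrite invrM // mulrACA [_^-1 * _]mulrC.
Qed.

Lemma rat_valueN q x : rat_value q x -> rat_value (- q) (- x).
Proof.
by move=> qx; rewrite -mulN1r -[- x]mulN1r; apply: rat_valueM qx;
  apply: (rat_value_int (-1)).
Qed.

Lemma rat_valueB q1 q2 x1 x2 : rat_value q1 x1 -> rat_value q2 x2 ->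
  rat_value (q1 - q2) (x1 - x2).
Proof. by move=> h1 h2; apply: rat_valueD => //; apply: rat_valueN. Qed.

Lemma rat_valueV (n : int) :
  n%:~R \is a @GRing.unit R -> rat_value n%:~R^-1 n%:~R^-1.
Proof. by move=> Un; exists 1, n; rewrite !mul1r. Qed.

End RationalValue.

(** * The hypergeometric side *)

Section RationalValueBig.
Variable R : comUnitRingType.

Lemma rat_value_prod (I : Type) (r : seq I) (P : pred I) F (G : I -> R) :
  (forall i, P i -> rat_value (F i) (G i)) ->
  rat_value (\prod_(i <- r | P i) F i) (\prod_(i <- r | P i) G i).
Proof.
move=> FG; elim/big_rec2: _ => [|i x y Pi]; first exact: rat_value_int 1.
by apply: rat_valueM; apply: FG.
Qed.

Lemma rat_value_sum (I : Type) (r : seq I) (P : pred I) F (G : I -> R) :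
  (forall i, P i -> rat_value (F i) (G i)) ->
  rat_value (\sum_(i <- r | P i) F i) (\sum_(i <- r | P i) G i).
Proof.
move=> FG; elim/big_rec2: _ => [|i x y Pi]; first exact: rat_value_int 0.
by apply: rat_valueD; apply: FG.
Qed.

Lemma rat_value_rising_factorial q (x : R) n : rat_value q x ->
  rat_value (rising_factorial q n) (\prod_(0 <= i < n) (x + i%:R)).
Proof.
by move=> qx; apply: rat_value_prod => i _; apply/rat_valueD/rat_value_nat.
Qed.

Lemma rising_factorial1 (F : fieldType) n : rising_factorial (1 : F) n = n`!%:R.
Proof.
rewrite /rising_factorial fact_prod big_add1 natr_prod.
by apply: eq_bigr => i _; rewrite nat1r.
Qed.

Lemma rat_value_hypergeom q1 q2 (x1 x2 : R) n :
  rat_value q1 x1 -> rat_value q2 x2 ->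
  (forall k, (k < n.+1)%N -> (k`!%:R : R) \is a GRing.unit) ->
  rat_value (trunc_hypergeom [:: q1; q2] [:: 1] 1 n)
    (\sum_(0 <= k < n.+1) \prod_(0 <= i < k) (x1 + i%:R) *
      \prod_(0 <= i < k) (x2 + i%:R) / k`!%:R ^+ 2).
Proof.
move=> v1 v2 Uf; rewrite /trunc_hypergeom big_nat [X in rat_value _ X]big_nat.
apply: rat_value_sum => k /andP[_ ltk].
rewrite !big_cons !big_nil !mulr1 rising_factorial1 expr1n mul1r -mulrA.
have UV : rat_value (k`!%:R)^-1 (k`!%:R^-1 : R).
  exact: (@rat_valueV R k`! (Uf k ltk)).
rewrite -exprVn expr2; apply: rat_valueM; last exact: rat_valueM.
by apply: rat_valueM; apply: rat_value_rising_factorial.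
Qed.

End RationalValueBig.

(** * The exponents and the summation ranges *)

(** Otherwise 1, d - 1 and the residue of p would be three distinct residues prime to d. *)
Lemma modn_totient_le2 d p : (1 < d)%N -> (totient d <= 2)%N -> coprime d p ->
  (p %% d = 1)%N \/ (2 < d)%N /\ (p %% d = d.-1)%N.
Proof.
move=> d_gt1 tot_d co_dp; set r := (p %% d)%N.
have r_lt : (r < d)%N by rewrite ltn_mod; lia.
have co_dr : coprime d r by rewrite coprime_modr.
have r_neq0 : r != 0%N by apply: contraTneq co_dr => ->; rewrite /coprime gcdn0; lia.
have [r1|r_neq1] := eqVneq r 1%N; [by left|right].
have d_gt2 : (2 < d)%N by lia.
split=> //; apply/eqP; apply: contraTT tot_d => r_neq; rewrite -ltnNge.
have co_pred : coprime d d.-1 by rewrite coprime_sym coprimePn; lia.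
rewrite totient_count_coprime big_mkord.
pose i1 := Ordinal d_gt1; pose i2 := Ordinal r_lt.
have pred_lt : (d.-1 < d)%N by lia.
pose i3 := Ordinal pred_lt.
rewrite (bigD1 i1) //= (bigD1 i2) //= (bigD1 i3) /=; last first.
  by rewrite -!val_eqE /= [d.-1 == r]eq_sym r_neq andbT; lia.
by rewrite coprimen1 co_dr co_pred.
Qed.

Lemma padicG_boundE p (t : seq rat) k (n : nat) :
  n%:R - 1 <= ((-1 / (p%:R - 1)) :: rcons t ((p%:R - 2) / (p%:R - 1)))`_k
    * (p%:R - 1) < n%:R ->
  padicG_bound p t k = n.
Proof.
move=> bnd; rewrite /padicG_bound (@floor_def _ _ (n%:Z - 1)) ?subrK //.
by rewrite intrB.
Qed.

(* With m = floor ((p - 1) / d) and L = floor ((p - 1) (1 - 1 / d)), the pair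
   1/d, 1 - 1/d is congruent to -m, 1 + m modulo p in either order; the second
   alternative is p = -1 modulo d, where L is one less than p - 1 - m. *)
Lemma summation_ranges p d : prime p -> (1 < d)%N -> (d < p)%N ->
  (totient d <= 2)%N ->
  exists m L : nat, [/\ (m <= p.-1 - m)%N, (m <= L)%N, (m <= p.-1)%N,
    (p = m * d + 1 /\ L = p.-1 - m)%N \/ (p.+1 = m.+1 * d /\ L.+1 = p.-1 - m)%N
    & let t : seq rat := [:: 1 / d%:R; 1 - 1 / d%:R] in
      [/\ padicG_bound p t 0 = 0%N, padicG_bound p t 1 = m.+1
        & padicG_bound p t 2 = L.+1]].
Proof.
move=> p_pr d_gt1 d_ltp tot_d.
have co : coprime d p.
  by rewrite coprime_sym prime_coprime // gtnNdvd //; lia.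
have q_gt0 : 0 < p%:R - 1 :> rat by rewrite subr_gt0 ltr1n prime_gt1.
have q_neq0 : p%:R - 1 != 0 :> rat by rewrite gt_eqF.
have d_gt0 : 0 < d%:R :> rat by rewrite ltr0n; lia.
have d_neq0 : d%:R != 0 :> rat by rewrite gt_eqF.
have d_inv : d%:R^-1 * d%:R = 1 :> rat by rewrite mulVf.
have b0 t : padicG_bound p t 0 = 0%N.
  by apply: padicG_boundE; rewrite /= divfK //; apply/andP; split; lra.
have dp := divn_eq p d; set m0 := (p %/ d)%N in dp.
have m0_gt0 : (0 < m0)%N by rewrite divn_gt0; lia.
case: (modn_totient_le2 d_gt1 tot_d co) => [r1|[d_gt2 r1]]; rewrite r1 in dp.
  have le : (2 * m0 <= m0 * d)%N by rewrite mulnC leq_mul.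
  have pE : p%:R = m0%:R * d%:R + 1 :> rat by rewrite -natrM natr1 -addn1 -dp.
  exists m0, (p.-1 - m0)%N; split; try lia; split=> //.
    apply: padicG_boundE; rewrite /= pE -natr1 !addrK div1r.
    rewrite mulrCA d_inv mulr1; apply/andP; split; lra.
  apply: padicG_boundE; rewrite /= -natr1 natrB; last by lia.
  have -> : p.-1%:R = m0%:R * d%:R :> rat by rewrite -natrM; congr _%:R; lia.
  rewrite pE !addrK div1r mulrBl mul1r mulrCA d_inv mulr1; apply/andP; split; lra.
have le : (3 * m0 <= m0 * d)%N by rewrite mulnC leq_mul.
have pE : p%:R = (m0%:R + 1) * d%:R - 1 :> rat.
  rewrite natr1 -natrM (_ : (m0.+1 * d = p.+1)%N); last by lia.
  by rewrite -natr1 addrK.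
have d2 : 2%:R < d%:R :> rat by rewrite ltr_nat.
have i2 : 0 < d%:R^-1 :> rat by rewrite invr_gt0.
have i1 : 2%:R * d%:R^-1 < 1 :> rat by rewrite ltr_pdivrMr // mul1r.
(* Here (p - 1) / d = m0 + 1 - 2 / d and (p - 1) (1 - 1 / d) = p - 2 - m0 + 2 / d, where d > 2 makes
   0 < 2 / d < 1. *)
exists m0, (p.-1 - m0).-1; split; try lia; split=> //.
  apply: padicG_boundE; rewrite /= pE -natr1 !addrK div1r.
  have -> : d%:R^-1 * ((m0%:R + 1) * d%:R - 1 - 1) = m0%:R + 1 - 2%:R * d%:R^-1 :> rat.
    by field.
  apply/andP; split; lra.
apply: padicG_boundE; rewrite /= prednK; last by lia.
rewrite natrB; last by lia.
have -> : p.-1%:R = p%:R - 1 :> rat.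
  by rewrite -{2}(prednK (prime_gt0 p_pr)) -natr1 addrK.
rewrite div1r pE.
have -> : (1 - d%:R^-1) * ((m0%:R + 1) * d%:R - 1 - 1) =
  ((m0%:R + 1) * d%:R - 1 - 1) - m0%:R - 1 + 2%:R * d%:R^-1 :> rat by field.
apply/andP; split; lra.
Qed.

(** * Gamma_p modulo p^2 at rational arguments *)

Section PadicGammaRational.
Variables (p : nat) (p_pr : prime p).
Hypothesis p_odd : odd p.
Local Notation Zp := (padic_int p_pr).
Local Notation R := ('Z_(p ^ 2)).

Definition gamma_mod (x : R) : R := gamma_nat R p x.

Lemma gamma_mod0 : gamma_mod 0 = 1.
Proof. by rewrite /gamma_mod /gamma_nat big_nil mul1r. Qed.

Lemma Zp2_unit_natr (n : nat) : ((n%:R : R) \is a GRing.unit) = ~~ (p %| n)%N.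
Proof. exact: (unit_natr_Zpow p_pr 1). Qed.

Lemma Zp2_natr_surj (x : R) : exists n, x = n%:R.
Proof. by exists x; rewrite natr_Zp. Qed.

Lemma Zp2_sq0 : p%:R * p%:R = 0 :> R.
Proof. by apply/eqP; rewrite -natrM (natr_Zpow_eq0 p_pr 1) mulnn. Qed.

Lemma gamma_modS (x : R) : gamma_mod (x + 1) = - unit_or_1 x * gamma_mod x.
Proof.
have -> : gamma_mod (x + 1) = gamma_nat R p (x : nat).+1.
  apply: (gamma_nat_Zpow p_pr p_odd (n := 1)); apply/eqP.
  by rewrite -(eq_natr_Zpow p_pr 1) -natr1 !natr_Zp.
have Ux : (x \is a GRing.unit) = ~~ (p %| (x : nat))%N.
  by rewrite -{1}[x]natr_Zp Zp2_unit_natr.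
by rewrite gamma_natS /unit_or_1 Ux if_neg natr_Zp.
Qed.

Lemma gamma_mod_unit (x : R) : gamma_mod x \is a GRing.unit.
Proof.
exact: (gamma_unit Zp2_natr_surj gamma_mod0 gamma_modS).
Qed.

Lemma padic_proj_gamma_ratr q (y : Zp) : rat_value q y ->
  padic_proj 1 (padic_gamma (ratr q : Zp)) = gamma_mod (padic_proj 1 y).
Proof. by move=> /rat_value_ratr ->; apply: padic_proj_gamma. Qed.

Lemma padic_proj_gamma_div q1 q2 (y1 y2 : Zp) :
  rat_value q1 y1 -> rat_value q2 y2 ->
  padic_proj 1 (padic_gamma (ratr q1 : Zp) / padic_gamma (ratr q2)) =
    gamma_mod (padic_proj 1 y1) / gamma_mod (padic_proj 1 y2).
Proof.
move=> v1 v2; have U : padic_gamma (ratr q2 : Zp) \is a GRing.unit.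
  apply: (@padic_unit_of_proj _ _ _ 1).
  by rewrite (padic_proj_gamma_ratr v2) gamma_mod_unit.
by rewrite rmorphM rmorphV //= (padic_proj_gamma_ratr v1) (padic_proj_gamma_ratr v2).
Qed.

End PadicGammaRational.

Theorem theorem4p3 (p : nat) (p_pr : prime p) (d : nat)
    (d_gt1 : (1 < d)%N) (d_ltp : (d < p)%N) (phi_d : (totient d <= 2)%N) :
  padic_eqmod 2
    (padicG p_pr [:: 1 / d%:R; 1 - 1 / d%:R])
    (ratr (trunc_hypergeom [:: 1 / d%:R : rat; 1 - 1 / d%:R] [:: 1] 1 p.-1)).
Proof.
have p_odd : odd p by case: (even_prime p_pr) => // p2; move: d_ltp; rewrite p2; lia.
have [m [L [lemM lemL lemp ranges [b0 b1 b2]]]] :=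
  summation_ranges p_pr d_gt1 d_ltp phi_d.
have p_gt0 := prime_gt0 p_pr.
have pd : ~~ (p %| d)%N by rewrite gtnNdvd //; lia.
have Ud : (d%:R : padic_int p_pr) \is a GRing.unit by apply: padic_natr_unit.
have pred_natr (S : pzRingType) : p%:R - 1 = p.-1%:R :> S.
  by rewrite -{1}(prednK p_gt0) -natr1 addrK.
have Uq : (p%:R - 1 : padic_int p_pr) \is a GRing.unit.
  by rewrite pred_natr; apply: padic_natr_unit; rewrite gtnNdvd //; lia.
have vq : rat_value ((p%:R - 1)^-1) ((p%:R - 1)^-1 : padic_int p_pr).
  by move: Uq; rewrite !pred_natr; apply: (@rat_valueV _ p.-1).
have va : rat_value (1 / d%:R) (d%:R^-1 : padic_int p_pr).
  by rewrite div1r; apply: (@rat_valueV _ d).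
have v1 : rat_value 1 (1 : padic_int p_pr) by exact: rat_value_nat 1.
have vb : rat_value (1 - 1 / d%:R) (1 - d%:R^-1 : padic_int p_pr) by apply: rat_valueB.
have vJ j : rat_value (j%:R / (p%:R - 1)) (j%:R / (p%:R - 1) : padic_int p_pr).
  by apply: rat_valueM vq; apply: rat_value_nat.
apply/padic_eqmodP; set a : 'Z_(p ^ 2) := d%:R^-1.
have aE : padic_proj 1 (d%:R^-1 : padic_int p_pr) = a by rewrite rmorphV //= rmorph_nat.
have JE j : padic_proj 1 (j%:R / (p%:R - 1) : padic_int p_pr) = j%:R / (p%:R - 1).
  by rewrite rmorphM rmorphV //= rmorphB rmorph1 !rmorph_nat.
have Ud' : (d%:R : 'Z_(p ^ 2)) \is a GRing.unit by rewrite Zp2_unit_natr.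
have ad : a * d%:R = 1 by rewrite mulVr.
(* Multiplied by d, the alternatives read p = m d + 1 and p + 1 = (m + 1) d. *)
have aC : a = p%:R * a - m%:R /\ L = (p.-1 - m)%N \/
    1 - a = p%:R * a - m%:R /\ L.+1 = (p.-1 - m)%N.
  case: ranges => [[pmd ->]|[pmd ->]]; [left|right]; split=> //.
    have pR (S : pzRingType) : p%:R = m%:R * d%:R + 1 :> S.
      by rewrite -natrM natr1 -addn1 -pmd.
    by apply: (mulIr Ud'); rewrite ad mulrBl -mulrA ad mulr1 pR; ring.
  apply: (mulIr Ud'); rewrite mulrBl mul1r ad mulrBl -mulrA ad mulr1.
  have pR (S : pzRingType) : p%:R + 1 = (m%:R + 1) * d%:R :> S.
    by rewrite !natr1 -natrM pmd.
  have := pR 'Z_(p ^ 2); rewrite mulrDl mul1r => e; 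
  by apply: (addIr 1); rewrite addrNK addrAC e; ring.
have := gamma_hypergeom_congr p_pr p_odd (Zp2_sq0 p_pr) (Zp2_unit_natr p_pr)
  (@Zp2_natr_surj p) (gamma_mod0 p) (gamma_modS p_pr p_odd)
  (subnKC lemp) lemM lemL aC.
set lhs := (X in X = _ -> _); set rhs := (X in _ = X -> _) => lhs_rhs.
transitivity lhs; last rewrite lhs_rhs.
  have le_args : 1 / d%:R <= 1 - 1 / d%:R :> rat.
    have d_gt0 : 0 < d%:R :> rat by rewrite ltr0n; lia.
    have d_ge2 : 2%:R <= d%:R :> rat by rewrite ler_nat.
    have : 2%:R * d%:R^-1 <= 1 :> rat by rewrite ler_pdivrMr ?mul1r.
    by rewrite div1r; lra.
  have sum3 (F : nat -> padic_int p_pr) : \sum_(0 <= k < 3) F k = F 0%N + F 1%N + F 2%N.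
    by rewrite !big_nat_recr //= big_geq // add0r.
  have prod00 (F : nat -> padic_int p_pr) : \prod_(0 <= k < 0) F k = 1.
    exact: big_geq.
  have prod01 (F : nat -> padic_int p_pr) : \prod_(0 <= k < 1) F k = F 0%N.
    exact: big_nat1.
  have prod12 (F : nat -> padic_int p_pr) : \prod_(1 <= k < 2) F k = F 1%N.
    exact: big_nat1.
  have prod02 (F : nat -> padic_int p_pr) : \prod_(0 <= k < 2) F k = F 0%N * F 1%N.
    by rewrite !big_nat_recr //= big_geq // mul1r.
  have signE j : teichmuller p_pr (-1) ^+ (j * 2) = 1.
    by rewrite mulnC exprM teichmullerN1_sqr expr1n.
  have aJE j : padic_proj 1 (d%:R^-1 - j%:R / (p%:R - 1) : padic_int p_pr)
      = a - j%:R / (p%:R - 1) by rewrite rmorphB /= aE JE.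
  have bE : padic_proj 1 (1 - d%:R^-1 : padic_int p_pr) = 1 - a.
    by rewrite rmorphB rmorph1 /= aE.
  have bJE j : padic_proj 1 (1 - d%:R^-1 - j%:R / (p%:R - 1) : padic_int p_pr)
      = 1 - a - j%:R / (p%:R - 1) by rewrite rmorphB /= bE JE.
  have cJE j : padic_proj 1 (1 + d%:R^-1 - j%:R / (p%:R - 1) : padic_int p_pr)
      = 1 + a - j%:R / (p%:R - 1) by rewrite rmorphB rmorphD rmorph1 /= aE JE.
  rewrite /padicG sort_le_id; last by rewrite /= le_args.
  (* The summand k = 2 carries p^2 and drops out before its gamma values are evaluated. *)
  have outerE (c x y z : padic_int p_pr) :
      padic_proj 1 (c * (x + - p%:R * y + (- p%:R) ^+ 2 * z)) =
      padic_proj 1 c * (padic_proj 1 x + - p%:R * padic_proj 1 y).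
    rewrite sqrrN !(rmorphM, rmorphD, rmorphN, rmorphXn, rmorph_nat) /=.
    by rewrite Zp2_sq0 // mul0r addr0.
  have cE : padic_proj 1 (- 1 / (p%:R - 1) : padic_int p_pr) = - 1 / (p%:R - 1).
    by rewrite !mulN1r rmorphN rmorphV //= rmorphB rmorph1 rmorph_nat.
  rewrite sum3 b0 b1 b2 expr0 mul1r expr1 outerE cE /lhs; congr (_ * (_ + _)).
    rewrite rmorph_sum; apply: eq_bigr => j _.
    rewrite signE mul1r prod02 prod00 mulr1 /= rmorphM rmorphXn /=.
    rewrite (padic_proj_gamma_ratr p_odd (vJ j)) JE.
    rewrite rmorphM /= (padic_proj_gamma_div p_odd (rat_valueB va (vJ j)) va).
    by rewrite (padic_proj_gamma_div p_odd (rat_valueB vb (vJ j)) vb) aJE bJE aE bE.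
  rewrite rmorph_sum; congr (_ * _); apply: eq_bigr => j _.
  rewrite signE mul1r prod12 prod01 /=.
  rewrite rmorphM [X in X * _]rmorphM rmorphXn /=.
  rewrite (padic_proj_gamma_ratr p_odd (vJ j)) JE.
  rewrite (padic_proj_gamma_div p_odd (rat_valueB vb (vJ j)) vb) bJE bE.
  by rewrite (padic_proj_gamma_div p_odd (rat_valueB (rat_valueD v1 va) (vJ j)) va) cJE aE.
(* The denominators k!^2 are prime to p, so [ratr] can be computed term by term. *)
have Uf k : (k < p.-1.+1)%N -> (k`!%:R : padic_int p_pr) \is a GRing.unit.
  rewrite prednK // => ltkp; rewrite fact_prod natr_prod big_add1 big_nat /=.
  apply: rpred_prod => i ltik.
  by apply: padic_natr_unit; rewrite gtnNdvd //; apply: leq_ltn_trans ltkp.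
rewrite (rat_value_ratr (rat_value_hypergeom va vb Uf)) prednK // rmorph_sum.
rewrite /rhs big_nat [RHS]big_nat; apply: eq_bigr => k /andP[_ ltkp].
rewrite /= rmorphM rmorphV ?unitrX ?Uf ?prednK //= rmorphXn rmorph_nat.
rewrite rmorphM !rmorph_prod; congr (_ * _ / _); apply: eq_bigr => i _.
  by rewrite rmorphD /= aE rmorph_nat.
by rewrite rmorphD /= rmorphB rmorph1 /= aE rmorph_nat.
Qed.
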